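(* Fix an integer $p\ge3$ and suppose $(\beta,h)\in\Theta=[0,\infty)\times\mathbb{R}$ is $p$-special. Assume $h$ is known, $\boldsymbol\sigma\sim\mathbb{P}_{\beta,h,p}$, and let $\hat\beta_N$ be the maximum likelihood estimate of $\beta$. Let $m_*=m_*(\beta,h,p)$ be the unique global maximizer of $H=H_{\beta,h,p}$. Then, as $N\to\infty$, $$N^{3/4}(\hat\beta_N-\beta)\xrightarrow{D}G_2,$$ where the distribution function of $G_2$ is $$G_2(t)=F_{0,0}\left(\int_{-\infty}^\infty u\,\mathrm dF_{t,0}(u)\right),$$ and, for $\bar\beta,\bar h\in\mathbb{R}$, $F_{\bar\beta,\bar h}$ is the probability distribution (function) on $\mathbb{R}$ with Lebesgue density proportional to $\exp\left(\frac{H^{(4)}(m_* )}{24}x^4+(\bar\beta p m_*^{p-1}+\bar h)x\right)$.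
   Context: The $p$-spin Curie-Weiss model is the probability measure on $\{-1,1\}^N$ given by $\mathbb{P}_{\beta,h,p}(\boldsymbol\sigma)=\frac{1}{2^NZ_N(\beta,h,p)}\exp\{N(\beta\overline\sigma_N^p+h\overline\sigma_N)\}$, where $\overline\sigma_N=\frac1N\sum_{i=1}^N\sigma_i$ and $Z_N$ is the normalizing constant; expectation is $\mathbb{E}_{\beta,h,p}$. The same formula defines the measure for every real $\beta$. For fixed known $h$, the maximum likelihood estimate $\hat\beta_N\in[-\infty,\infty]$ is the maximizer of the likelihood over all real $\beta$, i.e. the solution in $\beta\in\mathbb{R}$ of $\mathbb{E}_{\beta,h,p}(\overline\sigma_N^p)=\overline\sigma_N^p$; if no real solution exists, it equals $+\infty$ or $-\infty$ according to whether the likelihood is increasing or decreasing in $\beta$. Define $H_{\beta,h,p}:[-1,1]\to\mathbb{R}$ by $H_{\beta,h,p}(x)=\beta x^p+hx-I(x)$, $I(x)=\frac12\{(1+x)\log(1+x)+(1-x)\log(1-x)\}$. The point $(\beta,h)$ is $p$-special if $H_{\beta,h,p}$ has a unique global maximizer $m_*\in(-1,1)$ and $H_{\beta,h,p}''(m_* )=0$.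
   Formalization: The stated formula for G_2(t) is the distribution function only when m_*^{p-1}>0; when m_*^{p-1}<0 (p even, m_*<0) it is decreasing in t, so there the distribution function of G_2 is taken to be 1 − F_{0,0}(∫u dF_{t,0}(u)). *)

(* Defs.v *)
From HB Require Import structures.
From mathcomp Require Import all_boot all_order all_algebra.
From mathcomp Require Import all_classical all_reals all_analysis.
From mathcomp Require Import measurable_realfun ring.

Set Implicit Arguments.
Unset Strict Implicit.
Unset Printing Implicit Defensive.

Import Order.TTheory GRing.Theory Num.Theory.
Import numFieldNormedType.Exports.

Local Open Scope classical_set_scope.
Local Open Scope ring_scope.

(* A point of {-1,1}^N is encoded by bits; the i-th spin is (-1)^(s i). *)
Definition config (N : nat) := {ffun 'I_N -> bool}.

Section Model.
Context {R : realType}.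
Implicit Types (beta h : R) (p N : nat).

Definition spin (b : bool) : R := (-1) ^+ b.

Definition magnetization N (s : config N) : R :=
  N%:R^-1 * \sum_(i < N) spin (s i).

Definition gibbs_weight beta h p N (s : config N) : R :=
  expR (N%:R * (beta * magnetization s ^+ p + h * magnetization s)).

Definition partition_function beta h p N : R :=
  2 ^- N * \sum_(s : config N) gibbs_weight beta h p s.

Definition gibbs beta h p N (s : config N) : R :=
  (2 ^+ N * partition_function beta h p N)^-1 * gibbs_weight beta h p s.

Definition gibbs_expectation beta h p N (f : config N -> R) : R :=
  \sum_(s : config N) gibbs beta h p s * f s.

Definition likelihood h p N (s : config N) (b : R) : R := gibbs b h p s.

Definition likelihood_argmax h p N (s : config N) : set R :=
  [set b | forall b', likelihood h p s b' <= likelihood h p s b].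

Lemma gibbs_weight_shift h p N b b' (s : config N) :
  gibbs_weight b' h p s =
  gibbs_weight b h p s * expR (N%:R * (b' - b) * magnetization s ^+ p).
Proof. by rewrite /gibbs_weight -expRD; congr expR; ring. Qed.

Lemma gibbsE beta h p N (s : config N) :
  gibbs beta h p s =
  gibbs_weight beta h p s / \sum_(s' : config N) gibbs_weight beta h p s'.
Proof.
rewrite /gibbs /partition_function mulrA divff ?mul1r 1?mulrC// ?expf_neq0//.
Qed.

Lemma sum_gibbs_weight_gt0 beta h p N :
  0 < \sum_(s : config N) gibbs_weight beta h p s.
Proof.
rewrite (bigD1 [ffun=> true])//= ltr_wpDr ?expR_gt0//.
by apply: sumr_ge0 => s _; exact: expR_ge0.
Qed.

Lemma likelihood_le h p N (s : config N) b b' :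
  (likelihood h p s b' <= likelihood h p s b) =
  (\sum_(t : config N) gibbs_weight b h p t <=
   \sum_(t : config N) gibbs_weight b h p t *
     expR (N%:R * (b' - b) * (magnetization t ^+ p - magnetization s ^+ p))).
Proof.
rewrite /likelihood !gibbsE (gibbs_weight_shift h p b b' s).
set y := N%:R * (b' - b); set w := gibbs_weight b h p.
have -> : \sum_(t : config N) gibbs_weight b' h p t =
    expR (y * magnetization s ^+ p) * \sum_(t : config N) w N t *
      expR (y * (magnetization t ^+ p - magnetization s ^+ p)).
  rewrite mulr_sumr; apply: eq_bigr => t _; rewrite (gibbs_weight_shift h p b).
  by rewrite [RHS]mulrCA -[in RHS]expRD -/y; congr (_ * expR _); ring.
set D := \sum_(t : config N) _ * _; set e := expR (y * _).
have e0 : 0 < e by exact: expR_gt0.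
have w0 : 0 < w N s by exact: expR_gt0.
have D0 : 0 < D.
  rewrite /D (bigD1 s)//= ltr_wpDr ?mulr_gt0 ?expR_gt0//.
  by apply: sumr_ge0 => t _; rewrite mulr_ge0 ?expR_ge0.
rewrite (mulrC (w N s)) -mulf_div divff ?gt_eqF// mul1r ler_pM2l//.
by rewrite lef_pV2// posrE //; exact: sum_gibbs_weight_gt0.
Qed.

Lemma likelihood_argmaxE h p N (s : config N) b :
  likelihood_argmax h p s b <->
  gibbs_expectation b h p (fun t : config N => magnetization t ^+ p) =
    magnetization s ^+ p.
Proof.
pose w := @gibbs_weight b h p N.
pose d (t : config N) := magnetization t ^+ p - magnetization s ^+ p.
have W0 : 0 < \sum_t w t by exact: sum_gibbs_weight_gt0.
have EE : gibbs_expectation b h p (fun t : config N => magnetization t ^+ p) -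
    magnetization s ^+ p = (\sum_t w t * d t) / \sum_t w t.
  have -> : \sum_t w t * d t = \sum_t w t * magnetization t ^+ p -
      (\sum_t w t) * magnetization s ^+ p.
    by rewrite mulr_suml -sumrB; apply: eq_bigr => t _; rewrite mulrBr.
  rewrite mulrBl mulrAC divff ?gt_eqF// mul1r mulr_suml; congr (_ - _).
  by apply: eq_bigr => t _; rewrite gibbsE mulrAC.
split=> [bmax|].
- case: N => [|N] in s w d W0 EE bmax *.
    apply/eqP; rewrite -subr_eq0 EE big1 ?mul0r// => t _.
    by rewrite /d /magnetization !big_ord0 !mulr0 subrr mulr0.
  pose phi := \sum_(i < #|config N.+1|)
    (fun u => w (enum_val i) * expR (d (enum_val i) * u)) : R -> R.
  have phiE u : phi u = \sum_t w t * expR (d t * u).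
    by rewrite /phi fct_sumE -(big_enum_val (fun t => w t * expR (d t * u))).
  have dphi (u : R) : is_derive u 1 phi
      (\sum_(i < #|config N.+1|)
         w (enum_val i) * (d (enum_val i) * expR (d (enum_val i) * u))).
    apply: is_derive_sum => i.
    have : is_derive u 1 (fun v : R => d (enum_val i) * v) (d (enum_val i)).
      by have := is_deriveZ (d (enum_val i)) (is_derive_id u (1 : R)); rewrite scaler1.
    move=> /(is_derive1_comp (is_derive_expR _)) /(is_deriveZ (w (enum_val i))).
    by move=> /is_derive_eq; apply; rewrite [X in _ *: X]mulrC.
  have phimin u : phi 0 <= phi u.
    have N0 : N.+1%:R != 0 :> R by rewrite pnatr_eq0.
    have -> : phi 0 = \sum_t w t.
      by rewrite phiE; apply: eq_bigr => t _; rewrite mulr0 expR0 mulr1.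
    have := bmax (b + u / N.+1%:R); rewrite likelihood_le phiE.
    move=> /le_trans; apply; apply: ler_sum => t _.
    by rewrite addrAC subrr add0r mulrC [_ * (u / _)]mulrC divfK// [u * _]mulrC mulrC.
  have : is_derive (0 : R) 1 phi 0.
    apply: (@derive1_at_min _ phi (-1) 1) => //.
    by rewrite in_itv/= ltrN10 ltr01.
  move=> /@derive_val; rewrite (@derive_val _ _ _ _ _ _ _ (dphi 0)) => dphi0.
  apply/eqP; rewrite -subr_eq0 EE mulf_eq0; apply/orP; left; apply/eqP.
  rewrite -[RHS]dphi0 (big_enum_val (fun t => w t * d t)).
  by apply: eq_bigr => i _; rewrite mulr0 expR0 mulr1.
- move=> Eb b'; rewrite likelihood_le.
  have /eqP : gibbs_expectation b h p (fun t : config N => magnetization t ^+ p) -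
    magnetization s ^+ p = 0 by rewrite Eb subrr.
  rewrite EE mulf_eq0 invr_eq0 (gt_eqF W0) orbF => /eqP wd0.
  apply: (@le_trans _ _ (\sum_t w t * (1 + N%:R * (b' - b) * d t))).
    under [leRHS]eq_bigr do rewrite mulrDr mulr1 mulrCA.
    by rewrite big_split/= -mulr_sumr wd0 mulr0 addr0.
  by apply: ler_sum => t _; rewrite ler_pM2l ?expR_gt0// expR_ge1Dx.
Qed.

(* By likelihood_argmaxE the real values are the solutions of the moment
   equation. The maximizer is unique unless the likelihood is constant in b
   (e.g. N = 1 and p even), in which case any real may be returned. Without a
   maximizer the likelihood is strictly monotone in b. *)
Definition mle h p N (s : config N) : \bar R :=
  if `[< likelihood_argmax h p s !=set0 >]
  then (xget 0 (likelihood_argmax h p s))%:E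
  else if `[< {homo likelihood h p s : b b' / b <= b'} >] then +oo%E
  else -oo%E.

(* ln 0 = 0 in the library, so that entropy is right at the end points -1, 1. *)
Definition entropy (x : R) : R :=
  2^-1 * ((1 + x) * ln (1 + x) + (1 - x) * ln (1 - x)).

Definition Hfun beta h p (x : R) : R := beta * x ^+ p + h * x - entropy x.

Definition unique_global_maximizer (f : R -> R) (m : R) : Prop :=
  m \in `[-1, 1] /\ forall x, x \in `[-1, 1] -> x <> m -> f x < f m.

Definition p_special p beta h : Prop :=
  exists m, [/\ unique_global_maximizer (Hfun beta h p) m, -1 < m < 1
              & ((Hfun beta h p)^`(2))%classic m = 0].

End Model.

Section QuarticLaw.
Context {R : realType}.
Local Notation mu := (@lebesgue_measure R).

Definition quartic_exp (c b x : R) : R := expR (c * x ^+ 4 + b * x).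

Definition quartic_pdf (c b x : R) : R :=
  quartic_exp c b x / \int[mu]_(y in setT) quartic_exp c b y.

Definition quartic_law (c b : R) : set (measurableTypeR R) -> \bar R :=
  fun V => (\int[mu]_(x in V) (quartic_pdf c b x)%:E)%E.

Lemma quartic_pdf_ge0 c b x : 0 <= quartic_pdf c b x.
Proof.
rewrite /quartic_pdf divr_ge0 ?expR_ge0// fine_ge0//.
by apply: integral_ge0 => y _; rewrite lee_fin expR_ge0.
Qed.

Lemma measurable_quartic_pdf c b : measurable_fun setT (quartic_pdf c b).
Proof.
apply: measurable_funM => //; apply: measurableT_comp => //.
by apply: measurable_funD; apply: measurable_funM => //; exact: exprn_measurable.
Qed.

Section measure.
Variables c b : R.

Let quartic_law0 : quartic_law c b set0 = 0%E.
Proof. by rewrite /quartic_law integral_set0. Qed.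

Let quartic_law_ge0 V : (0 <= quartic_law c b V)%E.
Proof. by apply: integral_ge0 => x _; rewrite lee_fin quartic_pdf_ge0. Qed.

Let quartic_law_sigma_additive : semi_sigma_additive (quartic_law c b).
Proof.
move=> A mA tA mUA; rewrite /quartic_law ge0_integral_bigcup//=; last 2 first.
- apply: measurable_funTS; apply/measurable_EFinP; exact: measurable_quartic_pdf.
- by move=> x _; rewrite lee_fin quartic_pdf_ge0.
apply: is_cvg_ereal_nneg_natsum_cond => n _ _.
by apply: integral_ge0 => x _; rewrite lee_fin quartic_pdf_ge0.
Qed.

HB.instance Definition _ := isMeasure.Build _ _ _ (quartic_law c b)
  quartic_law0 quartic_law_ge0 quartic_law_sigma_additive.

End measure.
End QuarticLaw.

Section Limit.
Context {R : realType}.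

Definition distribution_function (G : set (measurableTypeR R) -> \bar R)
  (t : R) : R := fine (G `]-oo, t]%classic).

(* The law F_{bbar,hbar}, for the point (beta, h) with maximizer m. *)
Definition F_law (beta h : R) (p : nat) (m bbar hbar : R) :
    {measure set (measurableTypeR R) -> \bar R} :=
  quartic_law ((((Hfun beta h p)^`(4))%classic m) / 24) (bbar * p%:R * m ^+ p.-1 + hbar).

(* G2_formula is increasing in t if m ^+ p.-1 > 0. If m ^+ p.-1 < 0 (p even and
   h < 0) it is decreasing, and 1 - G2_formula is a distribution function. *)
Definition G2_formula (beta h : R) (p : nat) (m t : R) : R :=
  distribution_function (F_law beta h p m 0 0)
    (\int[F_law beta h p m t 0]_(u in setT) u).

(* X N is an extended-real random variable on the finite probability space
   (Omega N, P N); the limit law lives on R. *)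
Definition converges_in_distribution (Omega : nat -> finType)
    (P : forall N, Omega N -> R) (X : forall N, Omega N -> \bar R)
    (G : probability (measurableTypeR R) R) : Prop :=
  forall t : R, {for t, continuous (distribution_function G)} ->
    (fun N => \sum_(s : Omega N | (X N s <= t%:E)%E) P N s) @ \oo
      --> distribution_function G t.

End Limit.

(* Main.v *)
(* The function b |-> E_b[mean^p] is nondecreasing, so up to ties the event
   N^(3/4) (mle - beta) <= t says that mean^p <= E_b[mean^p] at
   b = beta + t N^(-3/4). At a special point the first three derivatives of H
   vanish and the fourth is -4 / (1 - m^2)^3 < 0. Stirling's formula and the
   quartic expansion of H turn sums over the magnetization levels, rescaled by
   N^(1/4) around m, into Riemann sums, and dominated convergence yields
   integrals against exp(c x^4 + s t x), with c = H^(4)(m) / 24 and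
   s = p m^(p-1). Hence N^(1/4) (mean^p - m^p) converges under beta to the law
   of s X, with X of law F_{0,0}, and N^(1/4) (E_b[mean^p] - m^p) converges to
   s times the mean of F_{t,0}: the limit is the probability that s X is at
   most this number. *)
Require Import Defs.
From HB Require Import structures.
From mathcomp Require Import all_boot all_order all_algebra.
From mathcomp Require Import all_classical all_reals all_analysis.
From mathcomp Require Import measurable_realfun ring lra.

Set Implicit Arguments.
Unset Strict Implicit.
Unset Printing Implicit Defensive.

Import Order.TTheory GRing.Theory Num.Theory.
Import numFieldNormedType.Exports.

Local Open Scope classical_set_scope.
Local Open Scope ring_scope.

(** * Taylor expansions at a critical point *)

Section Taylor.
Context {R : realType}.
Implicit Types (f g df : R -> R) (a c d e l x y : R).

(** The moment to which mean^p is compared varies with [N], so a limit law for mean^p alone does not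
    suffice. Hence [gibbs_expectation_cvg] takes test functions that depend on [N], grow at most
    linearly in the rescaled level and converge off one point. It yields the moment at [t] as well
    as probabilities at [t = 0], the latter for [<] and [<=], which enclose the event about the
    estimate and have the same limit because the limit law has no atoms. The sums are integrals of
    step functions without any error, each level being an end point of a cell of length
    [2 N^(-3/4)]. Domination needs a bound [- k (x - m)^4] of [H - H(m)] on all of [-1, 1], which
    compactness supplies, with room in it for the logarithmic growth of the binomial prefactor far
    from [m]. Stirling's constant is common to numerator and denominator and cancels. The factor [s]
    stays inside the event [s y <= v], so one function [limit_cdf] covers both signs and is a
    distribution function in each case; its limits at infinity rest on the unboundedness of the mean
    under large tilts. *)

Lemma is_derive_monomial a c x n :
  is_derive x 1 (fun y => a * (y - c) ^+ n) (a * (n%:R * (x - c) ^+ n.-1)).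
Proof.
have h : is_derive x 1 (fun z => z - c) 1 by apply: is_derive_eq; rewrite subr0.
have := is_deriveZ a (is_deriveX n h).
rewrite /GRing.scale/= mulr1; congr is_derive; apply/funext => y.
by rewrite exprfctE.
Qed.

(** Mean value theorem on the segment between [c] and [x]: the intermediate point is no farther from
    [c] than [x], so the monomial at [x] dominates. *)
Lemma growth_of_derive f df c d e n : 0 <= e ->
  (forall x, `|x - c| < d -> is_derive x 1 f (df x)) ->
  (forall x, `|x - c| < d -> `|df x| <= e * `|x - c| ^+ n) ->
  forall x, `|x - c| < d -> `|f x - f c| <= e * `|x - c| ^+ n.+1.
Proof.
move=> e0 fdf dfe x xd.
have d0 : `|c - c| < d by rewrite subrr normr0; exact: le_lt_trans xd.
have in_seg a b z : `|a - c| < d -> `|b - c| < d -> z \in `[a, b] -> `|z - c| < d.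
  rewrite in_itv/= !ltr_norml => /andP[? ?] /andP[? ?] /andP[? ?].
  by apply/andP; split; lra.
have fcont a b : `|a - c| < d -> `|b - c| < d -> {within `[a, b], continuous f}.
  move=> ad bd; apply: derivable_within_continuous => z zab.
  by have [] := fdf _ (in_seg _ _ _ ad bd zab).
have fder a b : `|a - c| < d -> `|b - c| < d ->
    forall z, z \in `]a, b[ -> is_derive z 1 f (df z).
  move=> ad bd z zab; apply: fdf; apply: in_seg ad bd _.
  by apply: subset_itv_oo_cc zab.
suff [z [zd zx ->]] : exists z, [/\ `|z - c| < d, `|z - c| <= `|x - c| &
    `|f x - f c| = `|df z| * `|x - c|].
  rewrite exprSr mulrA ler_wpM2r//.
  by rewrite (le_trans (dfe _ zd))// ler_wpM2l// lerXn2r ?nnegrE.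
have [xc|cx] := leP x c.
- have [z zxc fE] := MVT_segment xc (fder _ _ xd d0) (fcont _ _ xd d0).
  exists z; split; first exact: in_seg xd d0 zxc.
    move: zxc; rewrite in_itv/= => /andP[xz zc].
    by rewrite !ler0_norm ?subr_le0//; lra.
  by rewrite distrC fE normrM (distrC c).
- have [z zxc fE] := MVT_segment (ltW cx) (fder _ _ d0 xd) (fcont _ _ d0 xd).
  exists z; split; first exact: in_seg d0 xd zxc.
    move: zxc; rewrite in_itv/= => /andP[cz zx].
    by rewrite !ger0_norm ?subr_ge0 ?(ltW cx)//; lra.
  by rewrite fE normrM.
Qed.

(** [growth_of_derive] for [f] minus the antiderivative of the monomial. Each use integrates an
    expansion once without changing [e]. *)
Lemma growth_of_derive_monomial f df c d e a n : 0 <= e ->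
  (forall x, `|x - c| < d -> is_derive x 1 f (df x)) ->
  (forall x, `|x - c| < d -> `|df x - a * (x - c) ^+ n| <= e * `|x - c| ^+ n) ->
  forall x, `|x - c| < d ->
    `|f x - f c - a / n.+1%:R * (x - c) ^+ n.+1| <= e * `|x - c| ^+ n.+1.
Proof.
move=> e0 fdf dfe x xd.
pose g y := f y - a / n.+1%:R * (y - c) ^+ n.+1.
have gder y : `|y - c| < d -> is_derive y 1 g (df y - a * (y - c) ^+ n).
  move=> /fdf fy.
  have := is_deriveB fy (is_derive_monomial (a / n.+1%:R) c y n.+1).
  by rewrite -pred_Sn mulrA divfK// pnatr_eq0.
have := growth_of_derive e0 gder dfe xd.
by rewrite /g subrr expr0n/= mulr0 subr0 addrAC.
Qed.

Lemma derive_first_order f c l : is_derive c 1 f l -> forall e, 0 < e ->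
  exists2 d : R, 0 < d & forall x, `|x - c| < d ->
    `|f x - f c - l * (x - c)| <= e * `|x - c|.
Proof.
move=> [fc fl] e e0.
have /cvgrPdist_le/(_ _ e0) : h^-1 *: ((f \o shift c) (h *: 1) - f c) @[h --> 0^'] --> l.
  by rewrite -fl; exact: fc.
rewrite near_withinE => /nbhs_ballP[d/= d0 dP]; exists d => // x xd.
have [->|xc] := eqVneq x c; first by rewrite !subrr mulr0 subr0 !normr0 mulr0.
have xc0 : x - c != 0 by rewrite subr_eq0.
have := dP (x - c); rewrite /ball/= sub0r normrN => /(_ xd xc0).
rewrite /GRing.scale/= mulr1 subrK => h.
have -> : f x - f c - l * (x - c) = - (l - (x - c)^-1 * (f x - f c)) * (x - c).
  by rewrite opprB mulrBl mulrAC mulVf// mul1r.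
by rewrite normrM normrN ler_wpM2r.
Qed.

(** Peano form: the first-order expansion of [f2] at [c] is integrated twice, which turns [l] into
    [l / 2 / 3]. *)
Lemma taylor3 f f1 f2 c d l : 0 < d ->
  (forall x, `|x - c| < d -> is_derive x 1 f (f1 x)) ->
  (forall x, `|x - c| < d -> is_derive x 1 f1 (f2 x)) ->
  is_derive c 1 f2 l -> f1 c = 0 -> f2 c = 0 ->
  forall e, 0 < e -> exists2 d' : R, 0 < d' & forall x, `|x - c| < d' ->
    `|f x - f c - l / 6 * (x - c) ^+ 3| <= e * `|x - c| ^+ 3.
Proof.
move=> d0 fd1 fd2 fd3 f1c f2c e e0.
have [d' d'0 h] := derive_first_order fd3 e0.
exists (Num.min d d'); first by rewrite lt_min d0.
have fd1' x : `|x - c| < Num.min d d' -> is_derive x 1 f (f1 x).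
  by rewrite lt_min => /andP[? _]; exact: fd1.
have fd2' x : `|x - c| < Num.min d d' -> is_derive x 1 f1 (f2 x).
  by rewrite lt_min => /andP[? _]; exact: fd2.
have h2 x : `|x - c| < Num.min d d' -> `|f2 x - l * (x - c) ^+ 1| <= e * `|x - c| ^+ 1.
  by rewrite lt_min => /andP[_ /h]; rewrite f2c subr0 !expr1.
have h1 := growth_of_derive_monomial (ltW e0) fd2' h2.
rewrite f1c in h1.
have h1' x : `|x - c| < Num.min d d' -> `|f1 x - l / 2 * (x - c) ^+ 2| <= e * `|x - c| ^+ 2.
  by move=> /h1; rewrite subr0.
move=> x xd; have := growth_of_derive_monomial (ltW e0) fd1' h1' xd.
by have -> : l / 2 / 3 = l / 6 by field.
Qed.

Lemma taylor4 f f1 f2 f3 c d l : 0 < d ->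
  (forall x, `|x - c| < d -> is_derive x 1 f (f1 x)) ->
  (forall x, `|x - c| < d -> is_derive x 1 f1 (f2 x)) ->
  (forall x, `|x - c| < d -> is_derive x 1 f2 (f3 x)) ->
  is_derive c 1 f3 l -> f1 c = 0 -> f2 c = 0 -> f3 c = 0 ->
  forall e, 0 < e -> exists2 d' : R, 0 < d' & forall x, `|x - c| < d' ->
    `|f x - f c - l / 24 * (x - c) ^+ 4| <= e * `|x - c| ^+ 4.
Proof.
move=> d0 fd1 fd2 fd3 fd4 f1c f2c f3c e e0.
have [d' d'0 h] := taylor3 d0 fd2 fd3 fd4 f2c f3c e0.
exists (Num.min d d'); first by rewrite lt_min d0.
have fd1' x : `|x - c| < Num.min d d' -> is_derive x 1 f (f1 x).
  by rewrite lt_min => /andP[? _]; exact: fd1.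
have h1 x : `|x - c| < Num.min d d' -> `|f1 x - l / 6 * (x - c) ^+ 3| <= e * `|x - c| ^+ 3.
  by rewrite lt_min => /andP[_ /h]; rewrite f1c subr0.
move=> x xd; have := growth_of_derive_monomial (ltW e0) fd1' h1 xd.
by have -> : l / 6 / 4 = l / 24 by field.
Qed.

End Taylor.

(** * Stirling bounds *)

Section Stirling.
Context {R : realType}.
Implicit Types (x y : R) (n k : nat).

Lemma is_derive_ln_shift x : -1 < x ->
  is_derive x 1 (fun y : R => ln (1 + y)) (1 + x)^-1.
Proof.
move=> x1; have h : is_derive x 1 (fun y : R => 1 + y) 1.
  by have := is_deriveD (is_derive_cst (1 : R) x 1) (is_derive_id x 1); rewrite add0r.
have x0 : 0 < 1 + x by lra.
have := is_derive1_comp (is_derive1_ln x0) h.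
by rewrite mulr1.
Qed.

Lemma is_derive_inv_shift (a x : R) : 0 < a + x ->
  is_derive x 1 (fun y : R => (a + y)^-1) (- (a + x) ^- 2).
Proof.
move=> x1; have h : is_derive x 1 (fun y : R => a + y) 1.
  by have := is_deriveD (is_derive_cst a x 1) (is_derive_id x 1); rewrite add0r.
have := is_deriveV (lt0r_neq0 x1) h.
by rewrite /GRing.scale/= mulr1.
Qed.

Lemma ge0_of_derive (f df : R -> R) x : 0 <= x ->
  (forall y, 0 <= y -> is_derive y 1 f (df y)) ->
  (forall y, 0 <= y -> 0 <= df y) -> f 0 <= f x.
Proof.
move=> x0 fdf df0.
have [|z|z] := @MVT_segment _ f df _ _ x0.
- by move=> y; rewrite in_itv/= => /andP[y0 _]; apply: fdf; exact: ltW.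
- by apply: derivable_within_continuous => y; rewrite in_itv/= => /andP[/fdf[]].
rewrite in_itv/= subr0 => /andP[z0 _] fE.
by rewrite -subr_ge0 fE mulr_ge0// df0.
Qed.

(** The difference of the sides has derivative [y^2 / ((1 + y) (2 + y)^2)]. At [x = 1/k] the bound
    reads [(k + 1/2) ln (1 + 1/k) >= 1]. *)
Lemma ln1D_ge x : 0 <= x -> 2 * x / (2 + x) <= ln (1 + x).
Proof.
move=> x0.
have := @ge0_of_derive (fun y => ln (1 + y) + (4 * (2 + y)^-1))
  (fun y => (1 + y)^-1 + 4 * - (2 + y) ^- 2) _ x0.
have -> : 2 * x / (2 + x) = 2 - 4 * (2 + x)^-1 by field; lra.
rewrite !addr0 ln1 add0r lerBlDr => h; apply: le_trans (h _ _).
- by have -> : 4 / 2 = 2 :> R by field.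
- move=> y y0; apply: is_deriveD; first by apply: is_derive_ln_shift; lra.
  by apply: (is_deriveZ 4); apply: is_derive_inv_shift; lra.
- move=> y y0.
  have -> : (1 + y)^-1 + 4 * - (2 + y) ^- 2 = y ^+ 2 / ((1 + y) * (2 + y) ^+ 2).
    by field; lra.
  by rewrite divr_ge0 ?mulr_ge0 ?sqr_ge0//; lra.
Qed.

(** The difference of the sides has derivative [y^2 / (2 (1 + y)^2)]. At [x = 1/n] the bound reads
    [n ln (1 + 1/n) <= 1 - 1 / (2 (n + 1))]. *)
Lemma ln1D_le x : 0 <= x -> ln (1 + x) <= x * (2 + x) / (2 * (1 + x)).
Proof.
move=> x0.
have := @ge0_of_derive (fun y => - ln (1 + y) + (2^-1 * y + - (2^-1 * (1 + y)^-1)))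
  (fun y => - (1 + y)^-1 + (2^-1 * 1 + - (2^-1 * - (1 + y) ^- 2))) _ x0.
have -> : x * (2 + x) / (2 * (1 + x)) = 2^-1 + (2^-1 * x + - (2^-1 * (1 + x)^-1)).
  by field; lra.
rewrite !addr0 ln1 oppr0 add0r mulr0 add0r => h.
have : - (2^-1 / 1) <= - ln (1 + x) + (2^-1 * x - 2^-1 / (1 + x)) :> R; last by lra.
apply: h.
- move=> y y0.
  have y1 : -1 < y by lra.
  have y2 : 0 < 1 + y by lra.
  have d1 := is_deriveN (is_derive_ln_shift y1).
  have d2 := is_deriveZ 2^-1 (is_derive_id y (1 : R)).
  have d3 := is_deriveN (is_deriveZ 2^-1 (is_derive_inv_shift y2)).
  exact: is_deriveD d1 (is_deriveD d2 d3).
- move=> y y0.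
  have -> : - (1 + y)^-1 + (2^-1 * 1 + - (2^-1 * - (1 + y) ^- 2)) = y ^+ 2 / (2 * (1 + y) ^+ 2).
    by field; lra.
  by rewrite divr_ge0 ?mulr_ge0 ?sqr_ge0//; lra.
Qed.

(* [n.+1] instead of [n] under the halved logarithm makes this valid, namely 0,
   at [n = 0]. *)
Definition log_stirling n : R :=
  ln n`!%:R + n%:R - ln n.+1%:R / 2 - n%:R * ln n%:R.

Lemma lnS n : (0 < n)%N -> ln n.+1%:R = ln n%:R + ln (1 + n%:R^-1) :> R.
Proof.
move=> n0; have n0' : 0 < n%:R :> R by rewrite ltr0n.
have n1 : 0 < 1 + n%:R^-1 :> R by rewrite addr_gt0 ?invr_gt0.
rewrite -lnM ?posrE// mulrDr mulr1 divff ?gt_eqF// -natr1//.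
Qed.

Lemma log_factS n : ln n.+1`!%:R = ln n.+1%:R + ln n`!%:R :> R.
Proof. by rewrite factS natrM lnM// posrE ltr0n ?fact_gt0. Qed.

(** The increment is [1 - n ln ((n + 1) / n) - ln (1 + 1 / (n + 1)) / 2], with first product 0 at
    [n = 0]; the bounds on the two logarithms leave errors [1 / (2 (n + 1))] of opposite signs. *)
Lemma log_stirling_nondecreasing : nondecreasing_seq log_stirling.
Proof.
apply/nondecreasing_seqP => n; rewrite /log_stirling log_factS.
have := @ln1D_le n.+1%:R^-1; rewrite invr_ge0 ler0n => /(_ isT) h1.
rewrite [in X in _ <= X](lnS (ltn0Sn n)).
have n1 : 0 < n.+1%:R :> R by rewrite ltr0n.
have {}h1 : ln (1 + n.+1%:R^-1) <= n.+1%:R^-1 :> R.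
  apply: le_ln1Dx; rewrite (lt_le_trans (ltrN10 R))// invr_ge0; exact: ltW.
suff h2 : n%:R * (ln n.+1%:R - ln n%:R) <= 1 - (2 * n.+1%:R)^-1 :> R.
  move: h1 h2; rewrite invfM; set a := ln n.+1%:R; set b := ln n%:R.
  set d := ln (1 + _); set i := n.+1%:R^-1; rewrite -(natr1 n) !mulrDl mul1r mulrBr.
  by set na := _ * a; set nb := _ * b; lra.
case: n n1 h1 => [_ _|n _ _]; first by rewrite mul0r mulr1; lra.
rewrite lnS// addrAC subrr add0r.
have := @ln1D_le n.+1%:R^-1; rewrite invr_ge0 ler0n => /(_ isT) h2.
have n0 : 0 < n.+1%:R :> R by rewrite ltr0n.
rewrite -[in leRHS](natr1 n.+1); move: n0 h2; set y := n.+1%:R => n0 h2.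
apply: le_trans (ler_wpM2l (ltW n0) h2) _.
rewrite le_eqVlt; apply/orP; left; apply/eqP; field.
by apply/andP; split; rewrite gt_eqF//; lra.
Qed.

Lemma log_stirling_ge0 n : 0 <= log_stirling n.
Proof.
have <- : log_stirling 0 = 0 by rewrite /log_stirling fact0 ln1 !mul0r addr0 !subr0.
exact: log_stirling_nondecreasing.
Qed.

Lemma log_stirling_le1 n : log_stirling n <= 1.
Proof.
(* The classical form, with [ln k] halved, decreases from [a 1 = 1] by [ln1D_ge], and [log_stirling]
   lies below it. *)
pose a k : R := ln k`!%:R + k%:R - ln k%:R / 2 - k%:R * ln k%:R.
have a1 : a 1%N = 1 by rewrite /a (_ : 1`! = 1)%N// ln1 mulr0 mul0r add0r !subr0.
have a_le k : a k.+1 <= 1.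
  elim: k => [|k IH]; first by rewrite a1.
  apply: le_trans IH; rewrite /a log_factS (lnS (ltn0Sn k)).
  have k0 : 0 < k.+1%:R :> R by rewrite ltr0n.
  have := @ln1D_ge k.+1%:R^-1; rewrite invr_ge0 ler0n => /(_ isT).
  rewrite -[X in _ + X%:R](addn1 k.+1) -[X in _ - X%:R * _](addn1 k.+1) natrD.
  have -> : 2 * k.+1%:R^-1 / (2 + k.+1%:R^-1) = (k.+1%:R + 2^-1)^-1 :> R.
    by move: k0; set y := k.+1%:R => k0; field; lra.
  move: k0; set y := k.+1%:R => k0.
  rewrite -div1r ler_pdivrMr; last by lra.
  rewrite !mulrDl !mulrDr !mul1r; set u := ln _; set l := ln y.
  by set yl := y * l; set yu := y * u; rewrite (mulrC u) -/yu; lra.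
case: n => [|n]; first by rewrite /log_stirling fact0 ln1 !mul0r addr0 !subr0.
apply: le_trans (a_le n); rewrite /log_stirling /a lerD2r lerD2l lerN2.
by rewrite ler_pM2r// ler_ln ?posrE ?ltr0n// ler_nat.
Qed.

(** The limit is [ln (sqrt (2 pi))]; it enters only through a factor common to numerator and
    denominator of an expectation. *)
Lemma log_stirling_cvg : exists l : R, log_stirling n @[n --> \oo] --> l.
Proof.
exists (sup (range log_stirling)); apply: nondecreasing_cvgn.
  exact: log_stirling_nondecreasing.
by exists 1 => _ [n _ <-]; exact: log_stirling_le1.
Qed.

End Stirling.

(** * The special point *)

Section Hfun_derivatives.
Context {R : realType}.
Context (p : nat) (beta h : R).
Implicit Types x m : R.

(** For [k > p] the falling factorial is 0, so the truncated exponent [p - k] is harmless; this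
    occurs at [p = 3], [k = 4]. *)
Let poly_part k x : R := beta * (p ^_ k)%:R * x ^+ (p - k).

Definition Hfun_derivative k x : R :=
  match k with
  | 0 => Hfun beta h p x
  | 1 => poly_part 1 x + (h - (ln (1 + x) - ln (1 - x)) / 2)
  | 2 => poly_part 2 x - ((1 + x)^-1 + (1 - x)^-1) / 2
  | 3 => poly_part 3 x + ((1 + x) ^- 2 - (1 - x) ^- 2) / 2
  | _ => poly_part 4 x - ((1 + x) ^- 3 + (1 - x) ^- 3)
  end.

Let is_derive_poly_part k x : is_derive x 1 (poly_part k) (poly_part k.+1 x).
Proof.
have := is_derive_monomial (beta * (p ^_ k)%:R) 0 x (p - k).
rewrite subr0 mulrA -(mulrA beta) -natrM -ffactnSr -subnS.
by congr is_derive; apply/funext => y; rewrite subr0.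
Qed.

Lemma is_derive_comp_opp (f : R -> R) x l :
  is_derive (- x) 1 f l -> is_derive x 1 (fun y => f (- y)) (- l).
Proof.
move=> fl; have h1 := is_deriveN (is_derive_id x (1 : R)).
by have := is_derive1_comp fl h1; rewrite mulrN1.
Qed.

(** The entropy is the even part of [g y = (1 + y) ln (1 + y)], and the constants 1 in the
    derivatives of [g y] and [g (- y)] cancel. *)
Let is_derive_entropy x : -1 < x < 1 ->
  is_derive x 1 (@entropy R) ((ln (1 + x) - ln (1 - x)) / 2).
Proof.
move=> /andP[x1 x2].
pose g y : R := (1 + y) * ln (1 + y).
have dg (y : R) : -1 < y -> is_derive y 1 g (ln (1 + y) + 1).
  move=> y1; have := is_deriveD (is_derive_cst (1 : R) y 1) (is_derive_id y 1).
  move=> /is_deriveM /(_ (is_derive_ln_shift y1)).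
  have y0 : 1 + y != 0 by lra.
  rewrite [X in is_derive _ _ _ (X + _) -> _](_ : _ = 1); last exact: divff.
  by rewrite /GRing.scale/= add0r mulr1 (addrC 1 (ln _)).
have x1' : -1 < - x by lra.
have := is_deriveZ (2^-1) (is_deriveD (dg _ x1) (is_derive_comp_opp (dg _ x1'))).
rewrite /GRing.scale/=; have -> : 2^-1 * (ln (1 + x) + 1 - (ln (1 - x) + 1)) =
  (ln (1 + x) - ln (1 - x)) / 2 by lra.
by congr is_derive.
Qed.

Let is_derive_expV n x : 0 < 1 + x ->
  is_derive x 1 (fun y : R => (1 + y) ^- n) (- (n%:R * (1 + x) ^- n.+1)).
Proof.
move=> x0.
have := is_deriveX n (is_derive_inv_shift x0).
have -> : (n%:R * (1 + x)^-1 ^+ n.-1) *: - (1 + x) ^- 2 = - (n%:R * (1 + x) ^- n.+1).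
  rewrite /GRing.scale/= mulrN -mulrA; congr (- _).
  case: n => [|n]; first by rewrite !mul0r.
  by rewrite -!exprVn -exprD addn2.
by congr is_derive; apply/funext => y; rewrite exprfctE exprVn.
Qed.

Lemma is_derive_Hfun_derivative k x : (k < 4)%N -> -1 < x < 1 ->
  is_derive x 1 (Hfun_derivative k) (Hfun_derivative k.+1 x).
Proof.
move=> k4 x1; have x11 : 0 < 1 + x by lra.
have x12 : 0 < 1 + - x by lra.
have dV n := is_derive_expV n x11.
have dVN n := is_derive_comp_opp (is_derive_expV n x12).
case: k k4 => [|[|[|[|]]]]//= _.
- have := is_deriveB (is_deriveD (is_derive_poly_part 0 x)
    (is_deriveZ h (is_derive_id x 1))) (is_derive_entropy x1).
  rewrite /GRing.scale/= mulr1 addrA.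
  congr is_derive; apply/funext => y.
  by rewrite /Hfun /poly_part /= ffactn0 mulr1 subn0.
- have l1 : -1 < x by lra.
  have l2 : -1 < - x by lra.
  have := is_deriveD (is_derive_poly_part 1 x)
    (is_deriveB (is_derive_cst h x 1) (is_deriveZ 2^-1
    (is_deriveB (is_derive_ln_shift l1) (is_derive_comp_opp (is_derive_ln_shift l2))))).
  rewrite /GRing.scale/= add0r opprK [2^-1 * _]mulrC.
  by congr is_derive; apply/funext => y /=; rewrite [X in _ = _ + (_ - X)]mulrC.
- have := is_deriveB (is_derive_poly_part 2 x)
    (is_deriveZ 2^-1 (is_deriveD (dV 1%N) (dVN 1%N))).
  rewrite /GRing.scale/= !mul1r opprK.
  have -> : 2^-1 * (- (1 + x) ^- 2 + (1 - x) ^- 2) = - (((1 + x) ^- 2 - (1 - x) ^- 2) / 2) by lra.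
  rewrite opprK.
  by congr is_derive; apply/funext => y /=; rewrite [X in _ = _ - X]mulrC.
- have := is_deriveD (is_derive_poly_part 3 x)
    (is_deriveZ 2^-1 (is_deriveB (dV 2%N) (dVN 2%N))).
  rewrite /GRing.scale/= !opprK.
  have -> : 2^-1 * (- (2 * (1 + x) ^- 3) - 2 * (1 - x) ^- 3) = - ((1 + x) ^- 3 + (1 - x) ^- 3) by lra.
  by congr is_derive; apply/funext => y /=; rewrite [X in _ = _ + X]mulrC.
Qed.

Lemma derive1n_Hfun k x : (k <= 4)%N -> -1 < x < 1 ->
  ((Hfun beta h p)^`(k))%classic x = Hfun_derivative k x.
Proof.
elim: k x => [//|k IH] x k4 x1.
rewrite derive1nS derive1E.
(* The closed form is known on []-1, 1[] only, which is a neighbourhood of [x]. *)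
rewrite (@near_eq_derive _ _ _ _ (Hfun_derivative k)).
  exact: (@derive_val _ _ _ _ _ _ _ (is_derive_Hfun_derivative k4 x1)).
have : \forall y \near x, y \in `]-1, 1[ by apply: near_in_itvoo; rewrite in_itv.
by apply: filterS => y; rewrite in_itv/= => y1; rewrite IH// ltnW.
Qed.

End Hfun_derivatives.

Section Special_point.
Context {R : realType} (p : nat) (beta h m : R).
Hypotheses (p3 : (3 <= p)%N) (mmax : unique_global_maximizer (Hfun beta h p) m)
  (m_gt : -1 < m) (m_lt : m < 1)
  (H2m : ((Hfun beta h p)^`(2))%classic m = 0).
Local Notation H := (Hfun_derivative p beta h).
Implicit Types d e x : R.

Let m1 : -1 < m < 1. Proof. by rewrite m_gt m_lt. Qed.
Let m_bounds : -1 < m /\ m < 1. Proof. by split. Qed.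

Lemma special_point_ball : exists2 d : R, 0 < d & forall x, `|x - m| < d -> -1 < x < 1.
Proof.
have [mlo mhi] := m_bounds.
exists (Num.min (1 - m) (1 + m)); first by rewrite lt_min; apply/andP; split; lra.
by move=> x; rewrite lt_min !ltr_norml => /andP[/andP[? ?] /andP[? ?]]; lra.
Qed.

Lemma special_point_derivative1 : H 1 m = 0.
Proof.
have [mlo mhi] := m_bounds.
have m1' : m \in `]-1, 1[ by rewrite in_itv.
have dH x : x \in `]-1, 1[ -> is_derive x 1 (H 0) (H 1 x).
  by rewrite in_itv/= => x1; exact: is_derive_Hfun_derivative.
have := @derive1_at_max _ (H 0) (-1) 1 m _ _ m1' _.
move=> hmax; have {hmax} h0 : is_derive m 1 (H 0) 0.
  apply: hmax; first by lra.
    by move=> t /dH [].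
  move=> t; rewrite in_itv/= => /andP[t1 t2].
  have [->//|/eqP tm] := eqVneq t m.
  by apply/ltW/mmax.2 => //; rewrite in_itv/=; lra.
by rewrite -(@derive_val _ _ _ _ _ _ _ (dH _ m1')) (@derive_val _ _ _ _ _ _ _ h0).
Qed.

Lemma special_point_derivative2 : H 2 m = 0.
Proof. by rewrite -derive1n_Hfun. Qed.

(* A nonzero third derivative would make [H] cubic, hence sign changing, near
   its maximizer. *)
Lemma special_point_derivative3 : H 3 m = 0.
Proof.
have [d d0 dm] := special_point_ball.
apply/eqP/negPn/negP => H3.
have dH k x : (k < 4)%N -> `|x - m| < d -> is_derive x 1 (H k) (H k.+1 x).
  by move=> k4 /dm; exact: is_derive_Hfun_derivative.
have dmm : `|m - m| < d by rewrite subrr normr0.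
(* The cubic coefficient is [H 3 m / 6]; an error of half its size cannot change the sign. *)
have e0 : 0 < `|H 3 m| / 12 by rewrite divr_gt0// normr_gt0.
have [d' d'0 T] := taylor3 d0 (fun x => dH 0%N x isT) (fun x => dH 1%N x isT)
  (dH 2%N m isT dmm) special_point_derivative1 special_point_derivative2 e0.
pose r := Num.min d d' / 2.
have dd0 : 0 < Num.min d d' by rewrite lt_min d0.
have r0 : 0 < r by rewrite divr_gt0.
have rd : r < d /\ r < d'.
  have : r < Num.min d d' by rewrite /r; lra.
  by rewrite lt_min => /andP[].
(* The side of [m] on which the cubic term is positive. *)
pose x := m + Num.sg (H 3 m) * r.
have xm : x - m = Num.sg (H 3 m) * r by rewrite /x addrAC subrr add0r.
have nxm : `|x - m| = r by rewrite xm normrM normr_sg H3 mul1r gtr0_norm.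
have : Hfun beta h p x < Hfun beta h p m.
  have x1 : -1 < x < 1 by apply: dm; rewrite nxm rd.1.
  apply: mmax.2; first by rewrite in_itv/=; lra.
  by move=> xE; move: nxm; rewrite xE subrr normr0 => r00; rewrite -r00 ltxx in r0.
have := T x; rewrite nxm => /(_ rd.2).
rewrite xm ler_norml => /andP[+ _].
have -> : H 3 m / 6 * (Num.sg (H 3 m) * r) ^+ 3 = `|H 3 m| / 6 * r ^+ 3.
  rewrite exprMn exprS sqr_sg H3 mulr1 mulrA; congr (_ * _).
  by rewrite mulrAC (mulrC (H 3 m)) -normrEsg.
rewrite /=; have : 0 < `|H 3 m| * r ^+ 3 by rewrite mulr_gt0 ?normr_gt0// exprn_gt0.
have -> : `|H 3 m| / 6 * r ^+ 3 = `|H 3 m| * r ^+ 3 / 6 by rewrite mulrAC.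
have -> : `|H 3 m| / 12 * r ^+ 3 = `|H 3 m| * r ^+ 3 / 12 by rewrite mulrAC.
by set z := _ * _ ^+ 3; lra.
Qed.

(** At 0 the polynomial part of the second derivative vanishes because [p - 2 >= 1], and the entropy
    contributes -1. *)
Lemma special_point_neq0 : m != 0.
Proof.
apply/eqP => m0; have := special_point_derivative2; rewrite m0 /=.
rewrite expr0n subn_eq0 leqNgt p3 mulr0 addr0 subr0 invr1; lra.
Qed.

(* The relations [H 2 m = 0] and [H 3 m = 0] give
   [(p - 2) (1 - m ^+ 2) = 2 * m ^+ 2], which eliminates [p]. *)
Lemma special_point_derivative4 : H 4 m = - 4 / (1 - m ^+ 2) ^+ 3.
Proof.
have [mlo mhi] := m_bounds.
have m0 := special_point_neq0.
have := special_point_derivative2; have := special_point_derivative3; rewrite /=.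
move: p3; case: p => [|[|[|q]]]// _.
have -> : (q.+3 - 2 = q.+1)%N by rewrite subSS subSS subn0.
have -> : (q.+3 - 3 = q)%N by rewrite !subSS subn0.
have -> : (q.+3 - 4 = q.-1)%N by rewrite !subSS subn1.
rewrite (ffactnSr _ 3) !(ffactnSr _ 2).
have -> : (q.+3 - 2 = q.+1)%N by rewrite subSS subSS subn0.
have -> : (q.+3 - 3 = q)%N by rewrite !subSS subn0.
move: (q.+3 ^_ 2)%N => F; rewrite !natrM; set B := beta * F%:R.
rewrite !(mulrA beta) -/B -(natr1 q).
(* Multiplying by [m] absorbs the truncated predecessor: at [q = 0] both sides are 0. *)
have qm : q%:R * m ^+ q.-1 * m = q%:R * m ^+ q.
  by case: (q) => [|k]; rewrite ?mul0r// exprSr mulrA.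
rewrite (exprSr m q); move: qm; set u := m ^+ q; set w := m ^+ q.-1; set k := q%:R => qm.
move=> E3 E2.
have p0 : 1 + m != 0 by lra.
have n0 : 1 - m != 0 by lra.
have s0 : 1 - m ^+ 2 != 0.
  by rewrite -[X in X - _](expr1n _ 2) subr_sqr mulf_neq0.
have Q2 : B * (u * m) * (1 - m ^+ 2) = 1.
  apply/eqP; rewrite -subr_eq0; apply/eqP.
  have -> : B * (u * m) * (1 - m ^+ 2) - 1 =
    (B * (u * m) - ((1 + m)^-1 + (1 - m)^-1) / 2) * (1 - m ^+ 2) by field; lra.
  by rewrite E2 mul0r.
have Q3 : B * (k + 1) * u * (1 - m ^+ 2) ^+ 2 = 2 * m.
  apply/eqP; rewrite -subr_eq0; apply/eqP.
  have -> : B * (k + 1) * u * (1 - m ^+ 2) ^+ 2 - 2 * m =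
    (B * (k + 1) * u + ((1 + m) ^- 2 - (1 - m) ^- 2) / 2) * (1 - m ^+ 2) ^+ 2.
    by field; lra.
  by rewrite E3 mul0r.
have Q : (k + 1) * (1 - m ^+ 2) = 2 * m ^+ 2.
  have : (k + 1) * (1 - m ^+ 2) * (B * (u * m) * (1 - m ^+ 2)) = 2 * m ^+ 2.
    have -> : (k + 1) * (1 - m ^+ 2) * (B * (u * m) * (1 - m ^+ 2)) =
      B * (k + 1) * u * (1 - m ^+ 2) ^+ 2 * m by ring.
    by rewrite Q3; ring.
  by rewrite Q2 mulr1.
have Q4 : B * (k + 1) * k * w * (1 - m ^+ 2) ^+ 2 = 2 * k.
  apply: (mulIf m0).
  have -> : B * (k + 1) * k * w * (1 - m ^+ 2) ^+ 2 * m =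
    B * (k + 1) * (1 - m ^+ 2) ^+ 2 * (k * w * m) by ring.
  rewrite qm.
  have -> : B * (k + 1) * (1 - m ^+ 2) ^+ 2 * (k * u) =
    k * (B * (k + 1) * u * (1 - m ^+ 2) ^+ 2) by ring.
  by rewrite Q3; ring.
apply: (mulIf (expf_neq0 3 s0)); rewrite divfK ?expf_neq0//.
have -> : (B * (k + 1) * k * w - ((1 + m) ^- 3 + (1 - m) ^- 3)) * (1 - m ^+ 2) ^+ 3 =
   B * (k + 1) * k * w * (1 - m ^+ 2) ^+ 2 * (1 - m ^+ 2) - (2 + 6 * m ^+ 2).
  by field; lra.
rewrite Q4.
have -> : 2 * k * (1 - m ^+ 2) = 2 * ((k + 1) * (1 - m ^+ 2)) - 2 * (1 - m ^+ 2) by ring.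
(* [4 m^2 - 2 (1 - m^2) - (2 + 6 m^2) = -4]. *)
by rewrite Q; ring.
Qed.

Definition quartic_coef := ((Hfun beta h p)^`(4))%classic m / 24.

Lemma quartic_coef_lt0 : quartic_coef < 0.
Proof.
have [mlo mhi] := m_bounds.
rewrite /quartic_coef derive1n_Hfun// special_point_derivative4.
have s0 : 0 < 1 - m ^+ 2.
  by rewrite -[X in X - _](expr1n _ 2) subr_sqr mulr_gt0; lra.
by rewrite mulNr mulNr oppr_lt0 !divr_gt0// exprn_gt0.
Qed.

Lemma quartic_expansion e : 0 < e -> exists2 d : R, 0 < d & forall x, `|x - m| < d ->
  `|Hfun beta h p x - Hfun beta h p m - quartic_coef * (x - m) ^+ 4| <=
    e * (x - m) ^+ 4.
Proof.
move=> e0; have [d d0 dm] := special_point_ball.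
have dH k x : (k < 4)%N -> `|x - m| < d -> is_derive x 1 (H k) (H k.+1 x).
  by move=> k4 /dm; exact: is_derive_Hfun_derivative.
have dmm : `|m - m| < d by rewrite subrr normr0.
have [d' d'0 T] := taylor4 d0 (fun x => dH 0%N x isT) (fun x => dH 1%N x isT)
  (fun x => dH 2%N x isT) (dH 3%N m isT dmm) special_point_derivative1
  special_point_derivative2 special_point_derivative3 e0.
exists d' => // x /T; rewrite /quartic_coef derive1n_Hfun//.
by rewrite -normrX [in X in _ <= _ * X]ger0_norm// exprn_even_ge0.
Qed.

End Special_point.

(** * Continuity of the entropy and the global quartic bound *)

Section Hfun_upper_bound.
Context {R : realType}.
Implicit Types (x y d e : R).

(** With [u = sqrt x]: [- ln x = 2 ln (1/u) <= 2/u] and [x = u^2]. The bound gives continuity of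
    [x ln x] at 0. *)
Lemma normr_xlnx_le x : 0 < x < 1 -> `|x * ln x| <= 2 * Num.sqrt x.
Proof.
move=> /andP[x0 x1]; have s0 : 0 < Num.sqrt x by rewrite sqrtr_gt0.
rewrite ler0_norm; last by rewrite mulr_ge0_le0 ?ln_le0// ltW.
have lnE : - ln x = 2 * ln (Num.sqrt x)^-1.
  rewrite lnV ?posrE// mulrN; congr (- _).
  by rewrite -[in LHS](sqr_sqrtr (ltW x0)) lnXn// mulr_natl.
have h : ln (Num.sqrt x)^-1 <= (Num.sqrt x)^-1.
  by apply/ltW/ln_sublinear; rewrite invr_gt0.
rewrite -mulrN lnE -[X in X * _](sqr_sqrtr (ltW x0)) mulrCA ler_pM2l//.
apply: le_trans (ler_wpM2l (sqr_ge0 _) h) _.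
by rewrite expr2 mulfK ?gt_eqF.
Qed.

(* [ln] vanishes on nonpositive reals. *)
Lemma continuous_xlnx : continuous (fun x : R => x * ln x).
Proof.
move=> x; have [x0|x0|->] := ltgtP x 0.
- rewrite /continuous_at (ln0 (ltW x0)) mulr0; apply/cvgr0Pnorm_le => e e0.
  near=> y; rewrite ln0 ?mulr0 ?normr0 ?ltW//; near: y; exact: lt_nbhsl.
- by rewrite /continuous_at; apply: cvgM; [exact: cvg_id|exact: continuous_ln].
- rewrite /continuous_at mul0r; apply/cvgr0Pnorm_le => e e0.
  near=> y; have [y0|y0] := leP y 0; first by rewrite ln0// mulr0 normr0 ltW.
  have y1 : y < 1 by near: y; exact: lt_nbhsl.
  apply: le_trans (normr_xlnx_le _) _; first by rewrite y0 y1.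
  rewrite -ler_pdivlMl// -(ler_sqr (sqrtr_ge0 _)) ?nnegrE; last by rewrite mulr_ge0// ltW.
  rewrite sqr_sqrtr ?ltW//; near: y; apply: lt_nbhsl.
  by rewrite exprn_gt0// mulr_gt0.
Unshelve. all: by end_near. Qed.

Lemma continuous_entropy : continuous (@entropy R).
Proof.
move=> x.
pose g y : R := (1 + y) * ln (1 + y).
have cg : continuous g.
  move=> y; apply: (@continuous_comp _ _ _ (fun z : R => 1 + z) (fun z => z * ln z)).
    by apply: continuousD; [exact: cvg_cst|exact: cvg_id].
  exact: continuous_xlnx.
rewrite /continuous_at /entropy; apply: cvgM; first exact: cvg_cst.
apply: cvgD; first exact: cg.
apply: (@cvg_comp _ _ _ -%R g _ (nbhs (- x))); last exact: cg.
by apply: cvgN; exact: cvg_id.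
Qed.

Lemma continuous_Hfun p (beta h : R) : continuous (Hfun beta h p).
Proof.
move=> x; rewrite /continuous_at /Hfun; apply: cvgB; last exact: continuous_entropy.
by apply: cvgD; apply: cvgM; [exact: cvg_cst|exact: exprn_continuous|exact: cvg_cst|exact: cvg_id].
Qed.

(** Compactness makes the local bound global: off a neighbourhood of [m] the maximum of [H] on each
    remaining segment is strictly below [H m], and a fixed gap absorbs a small multiple of the
    bounded [(x - m)^4]. *)
Lemma Hfun_le_quartic p (beta h m c d : R) :
  unique_global_maximizer (Hfun beta h p) m -> -1 < m -> m < 1 -> 0 < c -> 0 < d ->
  (forall x, `|x - m| < d -> Hfun beta h p x - Hfun beta h p m <= - c * (x - m) ^+ 4) ->
  exists2 k : R, 0 < k & forall x, x \in `[-1, 1] ->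
    Hfun beta h p x - Hfun beta h p m <= - k * (x - m) ^+ 4.
Proof.
move=> mmax m_gt m_lt c0 d0 Hd.
pose r := Num.min d (Num.min (1 + m) (1 - m)).
have r0 : 0 < r by rewrite !lt_min d0/=; apply/andP; split; lra.
have [rd rl rr] : [/\ r <= d, r <= 1 + m & r <= 1 - m].
  by split; rewrite /r !ge_min ?lexx ?orbT.
have gap (a b : R) : a <= b -> {subset `[a, b] <= `[-1, 1]} -> m \notin `[a, b] ->
    exists2 k : R, 0 < k & forall x, x \in `[a, b] ->
      Hfun beta h p x - Hfun beta h p m <= - k * (x - m) ^+ 4.
  move=> ab ab1 mab.
  have cH : {within `[a, b], continuous (Hfun beta h p)}.
    by apply: continuous_subspaceT; exact: continuous_Hfun.
  have [z zab zmax] := EVT_max ab cH.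
  have zm : Hfun beta h p z < Hfun beta h p m.
    by apply: mmax.2; [exact: ab1|move=> zm; rewrite -zm zab in mab].
  (* [(x - m)^4 <= 16], because both points lie in [-1, 1]. *)
  exists ((Hfun beta h p m - Hfun beta h p z) / 16); first by rewrite divr_gt0 ?subr_gt0.
  move=> x xab; have := zmax _ xab.
  have /andP[x1 x2] : -1 <= x <= 1 by have := ab1 _ xab; rewrite in_itv.
  have : (x - m) ^+ 4 <= 16.
    rewrite (_ : (x - m) ^+ 4 = ((x - m) ^+ 2) ^+ 2); last by rewrite -exprM.
    have -> : 16 = 4 ^+ 2 :> R by rewrite -natrX.
    rewrite ler_sqr ?nnegrE ?sqr_ge0// (_ : 4 = 2 ^+ 2 :> R); last by rewrite -natrX.
    by rewrite -(real_normK (num_real (x - m))) ler_sqr ?nnegrE// ler_norml; lra.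
  rewrite mulNr; set D := Hfun beta h p m - _ => x16 Hx.
  have : D / 16 * (x - m) ^+ 4 <= D.
    by rewrite mulrAC ler_pdivrMr// ler_wpM2l// subr_ge0 ltW.
  by rewrite {2}/D; lra.
have [|y||k1 k10 k1P] := gap (-1) (m - r).
- by lra.
- by rewrite !in_itv/=; lra.
- by rewrite in_itv/=; lra.
have [|y||k2 k20 k2P] := gap (m + r) 1.
- by lra.
- by rewrite !in_itv/=; lra.
- by rewrite in_itv/=; lra.
exists (Num.min c (Num.min k1 k2)); first by rewrite !lt_min c0 k10.
move=> x; rewrite in_itv/= => /andP[x1 x2].
have mono k : Num.min c (Num.min k1 k2) <= k ->
  - k * (x - m) ^+ 4 <= - Num.min c (Num.min k1 k2) * (x - m) ^+ 4.
  by move=> hk; rewrite ler_wpM2r ?exprn_even_ge0// lerN2.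
have [xl|xl] := leP x (m - r).
  by apply: le_trans (k1P _ _) (mono _ _); rewrite ?in_itv/= ?x1// !ge_min lexx ?orbT.
have [xg|xg] := leP (m + r) x.
  by apply: le_trans (k2P _ _) (mono _ _); rewrite ?in_itv/= ?xg// !ge_min lexx ?orbT.
apply: le_trans (Hd _ _) (mono _ _); last by rewrite ge_min lexx.
by rewrite ltr_norml; lra.
Qed.

End Hfun_upper_bound.

(** * Quartic integrals *)

Section Dominated_integrals.
Context {R : realType}.
Local Notation mu := (@lebesgue_measure R).
Implicit Types (f g : R -> R) (b c k B C x y : R).

Lemma integrable_gauss_dominated f C : measurable_fun setT f ->
  (forall y, `|f y| <= C * gauss_fun y) -> mu.-integrable setT (EFin \o f).
Proof.
move=> mf fC; apply: (@le_integrable _ _ _ mu setT measurableT _ (fun y => (C * gauss_fun y)%:E)).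
- exact/measurable_EFinP.
- move=> y _ /=; rewrite lee_fin (le_trans (fC y))// ler_norm//.
- under eq_fun do rewrite EFinM.
  by apply: integrableZl => //; exact: integrableT_gauss.
Qed.

(* The exceptional point [y0] is the discontinuity of an indicator function. *)
Lemma dominated_cvg_Rintegral (f_ : nat -> R -> R) f C y0 :
  (forall n, measurable_fun setT (f_ n)) -> measurable_fun setT f ->
  (forall y, y <> y0 -> f_ n y @[n --> \oo] --> f y) ->
  (forall n y, (0 < n)%N -> `|f_ n y| <= C * gauss_fun y) ->
  (\int[mu]_y f_ n y)%R @[n --> \oo] --> (\int[mu]_y f y)%R.
Proof.
move=> mf_ mf f_f f_C.
(* The bound is assumed for positive indices, so the sequence is shifted by one, which keeps its
   limit. *)
have f_C' n y : `|f_ n.+1 y| <= C * gauss_fun y by exact: f_C.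
have iC : mu.-integrable setT (fun y => (C * gauss_fun y)%:E).
  under eq_fun do rewrite EFinM.
  by apply: integrableZl => //; exact: integrableT_gauss.
have [||||] := @dominated_convergence _ _ R mu setT measurableT
    (fun n y => (f_ n.+1 y)%:E) (EFin \o f) (fun y => (C * gauss_fun y)%:E) _ _ _ iC.
- by move=> n; apply/measurable_EFinP; exact: mf_.
- exact/measurable_EFinP.
- exists [set y0]; split => //; first exact: lebesgue_measure_set1.
  move=> y /= yf; apply: contrapT => yy0; apply: yf => _.
  by apply: cvg_EFin; [exact: nearW|rewrite (cvg_shiftS (fun n => f_ n y)); exact: f_f].
- by apply: aeW => y n _; rewrite lee_fin.
move=> /integrable_fin_num i_f _ h.
rewrite -(cvg_shiftS (fun n => (\int[mu]_y f_ n y)%R)); apply: fine_cvg.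
by rewrite fineK// i_f.
Qed.

(** [1 + |y| <= expR |y|]; completing squares bounds [(B + 1) |y|] by [(B + 1)^2 + y^2] and
    [3 y^2 - k y^4] by [9 / (4 k)]. The Gaussian exponent is 2 rather than 1 to leave room for
    replacing [y] by another point of its cell. *)
Lemma quartic_domination k B : 0 < k -> exists2 C : R, 0 < C & forall b y, `|b| <= B ->
  (1 + `|y|) * expR (- k * y ^+ 4 + b * y) <= C * expR (- (2 * y ^+ 2)).
Proof.
move=> k0; exists (expR ((B + 1) ^+ 2 + 9 / (4 * k))); first exact: expR_gt0.
move=> b y bB.
apply: (@le_trans _ _ (expR `|y| * expR (- k * y ^+ 4 + b * y))).
  by rewrite ler_wpM2r ?expR_ge0// expR_ge1Dx.
rewrite -!expRD ler_expR.
have by_ : b * y <= B * `|y|.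
  by apply: le_trans (ler_norm _) _; rewrite normrM ler_wpM2r.
have yy : `|y| ^+ 2 = y ^+ 2 by rewrite real_normK ?num_real.
have h1 : (B + 1) * `|y| <= (B + 1) ^+ 2 + y ^+ 2.
  rewrite -yy; set u := B + 1; set v := `|y|.
  by have := sqr_ge0 (u - v); have := sqr_ge0 u; have := sqr_ge0 v; rewrite sqrrB; lra.
have h2 : 3 * y ^+ 2 - k * y ^+ 4 <= 9 / (4 * k).
  rewrite ler_pdivlMr ?mulr_gt0//.
  have := sqr_ge0 (2 * k * y ^+ 2 - 3).
  have -> : (2 * k * y ^+ 2 - 3) ^+ 2 = 9 - (3 * y ^+ 2 - k * y ^+ 4) * (4 * k) by ring.
  by lra.
by move: h1; rewrite mulrDl mul1r mulNr; lra.
Qed.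

Lemma Rintegral_gt0 f x : continuous f -> mu.-integrable setT (EFin \o f) ->
  (forall y, 0 <= f y) -> 0 < f x -> 0 < (\int[mu]_y f y)%R.
Proof.
move=> cf intf f0 fx0.
have fx2 : 0 < f x / 2 by rewrite divr_gt0.
have /cvgrPdist_lt/(_ _ fx2)/nbhs_ballP[r/= r0 rP] := cf x.
have fr y : y \in `[x - r / 2, x + r / 2] -> f x / 2 <= f y.
  rewrite in_itv/= => /andP[y1 y2].
  have : ball x r y by rewrite /ball/= distrC ltr_norml; apply/andP; split; lra.
  by move=> /rP/=; rewrite distrC ltr_norml => /andP[+ _]; lra.
pose A := `[x - r / 2, x + r / 2]%classic.
have muA : mu A = r%:E.
  by rewrite lebesgue_measure_itv/= lte_fin ifT; [rewrite -EFinB; congr EFin; lra|lra].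
have mA : measurable A by exact: measurable_itv.
have mf : measurable_fun setT (EFin \o f) by exact: measurable_int intf.
have : ((f x / 2 * r)%:E <= \int[mu]_y (f y)%:E)%E.
  apply: (@le_trans _ _ (\int[mu]_(y in A) (f y)%:E)%E); last first.
    by apply: ge0_subset_integral => // y _; rewrite lee_fin.
  rewrite EFinM -muA -integral_cst//; apply: ge0_le_integral => //.
  - by move=> y _; rewrite lee_fin ltW.
  - exact: measurable_funTS.
rewrite /Rintegral -(fineK (integrable_fin_num measurableT intf)) lee_fin.
by apply: lt_le_trans; rewrite mulr_gt0.
Qed.

End Dominated_integrals.

Section Quartic_integrals.
Context {R : realType}.
Local Notation mu := (@lebesgue_measure R).
Implicit Types (f g : R -> R) (a b c k s t v B C K x y : R).

Lemma measurable_quartic_exp c b : measurable_fun setT (quartic_exp c b).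
Proof.
apply: measurableT_comp => //.
by apply: measurable_funD; apply: measurable_funM => //; exact: exprn_measurable.
Qed.

Lemma continuous_quartic_exp c b : continuous (quartic_exp c b).
Proof.
move=> y; rewrite /continuous_at /quartic_exp.
apply: (@cvg_comp _ _ _ (fun y => c * y ^+ 4 + b * y) (@expR R)); last exact: continuous_expR.
by apply: cvgD; apply: cvgM; [exact: cvg_cst|exact: exprn_continuous|exact: cvg_cst|exact: cvg_id].
Qed.

(** Uniformity in [b] allows convergent tilts under the integral, and the factor [1 + |y|] allows
    integrands of linear growth. *)
Lemma quartic_exp_gauss_bound c B : c < 0 -> exists2 C : R, 0 < C & forall b y, `|b| <= B ->
  (1 + `|y|) * quartic_exp c b y <= C * gauss_fun y.
Proof.
move=> c0; have [|C C0 CP] := @quartic_domination R (- c) B; first by rewrite oppr_gt0.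
exists C => // b y /CP => /(_ y); rewrite opprK => /le_trans; apply.
by rewrite ler_pM2l// ler_expR lerN2 ler_peMl ?sqr_ge0// ler1n.
Qed.

Lemma quartic_integrable c b g A : c < 0 -> measurable_fun setT g ->
  (forall y, `|g y| <= A * (1 + `|y|)) ->
  mu.-integrable setT (EFin \o (fun y => g y * quartic_exp c b y)).
Proof.
move=> c0 mg gA; have [C C0 CP] := quartic_exp_gauss_bound `|b| c0.
have A0 : 0 <= A by have := le_trans (normr_ge0 _) (gA 0); rewrite normr0 addr0 mulr1.
apply: (@integrable_gauss_dominated _ _ (A * C)).
  by apply: measurable_funM => //; exact: measurable_quartic_exp.
move=> y; rewrite normrM (ger0_norm (expR_ge0 _)).
apply: (@le_trans _ _ (A * (1 + `|y|) * quartic_exp c b y)).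
  by rewrite ler_wpM2r ?expR_ge0.
by rewrite -!mulrA ler_wpM2l// CP.
Qed.

Definition quartic_int c b g : R := (\int[mu]_y (g y * quartic_exp c b y))%R.

Lemma quartic_int_cst1 c b : quartic_int c b (cst 1) = (\int[mu]_y quartic_exp c b y)%R.
Proof. by rewrite /quartic_int; under eq_Rintegral do rewrite /= mul1r. Qed.

Definition quartic_mean c b : R := quartic_int c b id / quartic_int c b (cst 1).

Lemma quartic_integrable_affine c b a k : c < 0 ->
  mu.-integrable setT (EFin \o (fun y => (a * y + k) * quartic_exp c b y)).
Proof.
move=> c0; apply: (@quartic_integrable _ _ _ (`|a| + `|k|)) => //.
  by apply: measurable_funD => //; exact: measurable_funM.
move=> y; apply: le_trans (ler_normD _ _) _; rewrite normrM.
have := normr_ge0 a; have := normr_ge0 k; have := normr_ge0 y.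
set u := `|y|; set v := `|a|; set w := `|k| => u0 w0 v0.
by have := mulr_ge0 w0 u0; lra.
Qed.

Lemma quartic_integrable_cst1 c b : c < 0 ->
  mu.-integrable setT (EFin \o (fun y => cst 1 y * quartic_exp c b y)).
Proof.
move=> c0; have := quartic_integrable_affine b 0 1 c0.
by apply: eq_integrable => // y _ /=; rewrite mul0r add0r.
Qed.

Lemma quartic_integrable_id c b : c < 0 ->
  mu.-integrable setT (EFin \o (fun y => id y * quartic_exp c b y)).
Proof.
move=> c0; have := quartic_integrable_affine b 1 0 c0.
by apply: eq_integrable => // y _ /=; rewrite mul1r addr0.
Qed.

Lemma quartic_int_affine c b a k : c < 0 ->
  quartic_int c b (fun y => a * y + k) = a * quartic_int c b id + k * quartic_int c b (cst 1).
Proof.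
move=> c0; rewrite /quartic_int.
rewrite -!RintegralZl//; [|exact: quartic_integrable_cst1|exact: quartic_integrable_id].
rewrite -RintegralD//.
- by apply: eq_Rintegral => y _; rewrite mulrDl !mulrA mulr1.
- have := quartic_integrable_affine b a 0 c0.
  by apply: eq_integrable => // y _ /=; rewrite addr0 mulrA.
- have := quartic_integrable_affine b 0 k c0.
  by apply: eq_integrable => // y _ /=; rewrite mul0r add0r mul1r.
Qed.

Lemma quartic_int_cst1_gt0 c b : c < 0 -> 0 < quartic_int c b (cst 1).
Proof.
move=> c0; rewrite quartic_int_cst1; apply: (@Rintegral_gt0 _ _ 0).
- exact: continuous_quartic_exp.
- have := quartic_integrable_cst1 b c0.
  by apply: eq_integrable => // y _ /=; rewrite mul1r.
- by move=> y; exact: expR_ge0.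
- exact: expR_gt0.
Qed.

Lemma quartic_exp_tilt c b t y : quartic_exp c (b + t) y = expR (t * y) * quartic_exp c b y.
Proof. by rewrite /quartic_exp -expRD; congr expR; ring. Qed.

Lemma quartic_mean_le c b K : c < 0 ->
  (K <= quartic_mean c b) = (0 <= quartic_int c b (fun y => 1 * y + - K)).
Proof.
move=> c0; rewrite quartic_int_affine// mul1r mulNr subr_ge0.
by rewrite /quartic_mean ler_pdivlMr// quartic_int_cst1_gt0.
Qed.

Lemma quartic_int_centered c b : c < 0 ->
  quartic_int c b (fun y => 1 * y + - quartic_mean c b) = 0.
Proof.
move=> c0; rewrite quartic_int_affine// mul1r mulNr.
by rewrite {1}/quartic_mean divfK ?subrr// gt_eqF// quartic_int_cst1_gt0.
Qed.

(* [(y - K) (expR (t y) - expR (t K)) >= 0] for [t >= 0]. *)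
Lemma quartic_mean_nondecreasing c : c < 0 -> {homo quartic_mean c : b b' / b <= b'}.
Proof.
move=> c0 b b' bb'; rewrite quartic_mean_le//.
have K0 := quartic_int_centered b c0; move: K0; set K := quartic_mean c b => K0.
pose t := b' - b.
have t0 : 0 <= t by rewrite subr_ge0.
have b'E : b' = b + t by rewrite /t addrC subrK.
(* The vanishing centred integral at [b], times [expR (t * K)], becomes the left side, so that
   integrands can be compared pointwise. *)
rewrite -(mulr0 (expR (t * K))) -K0 /quartic_int -RintegralZl//; last exact: quartic_integrable_affine.
apply: le_Rintegral => //.
- have := quartic_integrable_affine b (expR (t * K)) (expR (t * K) * - K) c0.
  by apply: eq_integrable => // y _ /=; rewrite -mulrDr mulrA mul1r.
- exact: quartic_integrable_affine.
- move=> y _; rewrite b'E quartic_exp_tilt mul1r mulrA [X in _ <= X]mulrA.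
  rewrite ler_wpM2r ?expR_ge0// mulrC -subr_ge0 -mulrBr.
  have [yK|yK] := leP K y; first by rewrite mulr_ge0 ?subr_ge0// ler_expR ler_wpM2l.
  by rewrite mulr_le0// subr_le0 ?ler_expR ?ler_wpM2l// ltW.
Qed.

(* With [z = s y - K], [z expR (t z) >= max z 0 - 1/t]. *)
Lemma quartic_mean_unbounded c s K : c < 0 -> s != 0 ->
  exists t0 : R, forall t, t0 <= t -> K <= s * quartic_mean c (s * t).
Proof.
move=> c0 s0.
(* The positive part of [z = s y - K]; it equals 1 at [y = (K + 1) / s]. *)
pose g y : R := ((s * y - K) + `|s * y - K|) / 2.
have g0 y : 0 <= g y by rewrite divr_ge0//; have := ler_norm (- (s * y - K)); rewrite normrN; lra.
have cg : continuous g.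
  have cz : continuous (fun y : R => s * y - K).
    move=> y; apply: cvgB; last exact: cvg_cst.
    by apply: cvgM; [exact: cvg_cst|exact: cvg_id].
  move=> y; rewrite /continuous_at /g; apply: cvgM; last exact: cvg_cst.
  by apply: cvgD; [exact: cz|apply: cvg_norm; exact: cz].
have ig : mu.-integrable setT (EFin \o (fun y => g y * quartic_exp c 0 y)).
  apply: (@quartic_integrable _ _ _ (`|s| + `|K|)) => //; first exact: continuous_measurable_fun.
  move=> y; rewrite ger0_norm// /g.
  have h1 := ler_normB (s * y) K; have h2 := ler_norm (s * y - K).
  apply: (@le_trans _ _ (`|s * y| + `|K|)); first by lra.
  rewrite normrM; have := normr_ge0 s; have := normr_ge0 K; have := normr_ge0 y.
  set u := `|y|; set v := `|s|; set w := `|K| => u0 w0 v0.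
  by have := mulr_ge0 w0 u0; lra.
pose P := quartic_int c 0 g; pose Z := quartic_int c 0 (cst 1).
have Z0 : 0 < Z by exact: quartic_int_cst1_gt0.
have P0 : 0 < P.
  apply: (@Rintegral_gt0 _ _ ((K + 1) / s)) => //.
  - by move=> y; apply: cvgM; [exact: cg|exact: continuous_quartic_exp].
  - by move=> y; rewrite mulr_ge0 ?expR_ge0.
  - rewrite mulr_gt0 ?expR_gt0// /g (mulrC s) divfK// ger0_norm; lra.
(* [t >= Z / P] makes [P - Z / t] nonnegative, and [t >= 1] makes [t] positive. *)
exists (Num.max 1 (Z / P)) => t; rewrite ge_max => /andP[t1 tZ].
have t0 : 0 < t by lra.
have PZ : 0 <= expR (t * K) * (P - t^-1 * Z).
  by rewrite mulr_ge0 ?expR_ge0// subr_ge0 ler_pdivrMl// -ler_pdivrMr.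
rewrite /quartic_mean mulrA ler_pdivlMr ?quartic_int_cst1_gt0//.
rewrite -subr_ge0 -mulNr -quartic_int_affine//; apply: le_trans PZ _.
have iZ : mu.-integrable setT (EFin \o (fun y => t^-1 * (cst 1 y * quartic_exp c 0 y))).
  exact: (integrableZl measurableT t^-1 (quartic_integrable_cst1 0 c0)).
have iB : mu.-integrable setT (EFin \o (fun y => g y * quartic_exp c 0 y - t^-1 * (cst 1 y * quartic_exp c 0 y))).
  exact: (integrableB measurableT ig iZ).
rewrite /P /Z /quartic_int -RintegralZl//; last exact: quartic_integrable_cst1.
rewrite -RintegralB// -RintegralZl//; apply: le_Rintegral => //.
- exact: (integrableZl measurableT (expR (t * K)) iB).
- exact: quartic_integrable_affine.
- move=> y _ /=; rewrite mul1r -mulrBl mulrA.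
  have -> : s * t = 0 + t * s by rewrite add0r mulrC.
  rewrite quartic_exp_tilt mulrA ler_wpM2r ?expR_ge0// /g.
  have -> : t * s * y = t * K + t * (s * y - K) by ring.
  rewrite expRD mulrCA ler_pM2l ?expR_gt0//.
  move: (s * y - K) => z; have [z0|z0] := leP 0 z.
    rewrite (ger0_norm z0); have -> : (z + z) / 2 = z by field.
    have : z * 1 <= z * expR (t * z).
      by rewrite ler_wpM2l// -expR0 ler_expR mulr_ge0// ltW.
    have ti : 0 < t^-1 by rewrite invr_gt0.
    by rewrite mulr1; set e := _ * expR _; lra.
  rewrite (ltr0_norm z0) subrr mul0r sub0r.
  (* Here [z < 0]; with [u = - t z] the claim is [u expR (- u) <= 1]. *)
  rewrite -(ler_pM2l t0) mulrN divff ?gt_eqF// mulrA lerNl -mulNr -mulrN.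
  have := expR_ge1Dx (- (t * z)).
  rewrite expRN -mulrN; set u := t * - z => h.
  have e0 : 0 < expR (t * z) by exact: expR_gt0.
  rewrite -ler_pdivlMr// div1r; lra.
Qed.

(** Eventually each sequence is within half the gap of its limit, so ties disappear and weak and
    strict comparisons agree. *)
Lemma near_eq_le (u_ v_ : nat -> R) u v : u != v ->
  u_ n @[n --> \oo] --> u -> v_ n @[n --> \oo] --> v ->
  \forall n \near \oo, (u_ n <= v_ n) = (u <= v) /\ (u_ n < v_ n) = (u <= v).
Proof.
move=> uv uu vv; have d0 : 0 < `|u - v| / 2 by rewrite divr_gt0// normr_gt0 subr_eq0.
move/cvgrPdist_lt/(_ _ d0) : uu; move/cvgrPdist_lt/(_ _ d0) : vv.
apply: filterS2 => n; rewrite !ltr_norml.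
have [uv'|vu] := leP u v.
  rewrite (distrC u) ger0_norm ?subr_ge0// => /andP[? ?] /andP[? ?].
  have lt : u_ n < v_ n by lra.
  by rewrite lt ltW.
rewrite ger0_norm ?subr_ge0 ?(ltW vu)// => /andP[? ?] /andP[? ?].
have lt : v_ n < u_ n by lra.
by split; apply/negbTE; rewrite -?leNgt -?ltNge// ltW.
Qed.

Lemma indic_leE s v y : \1_[set y : R | s * y <= v] y = ((s * y <= v)%R)%:R :> R.
Proof.
rewrite indicE; have [h|h] := boolP (s * y <= v); first by rewrite mem_set.
by rewrite memNset//=; exact/negP.
Qed.

Lemma indic_le_homo s v v' y : v <= v' ->
  \1_[set y : R | s * y <= v] y <= \1_[set y : R | s * y <= v'] y :> R.
Proof.
move=> vv'; rewrite !indic_leE ler_nat.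
by case: (leP (s * y) v) => // /le_trans /(_ vv') ->.
Qed.

Lemma measurable_le_indic s v : measurable_fun setT (\1_[set y : R | s * y <= v] : R -> R).
Proof.
apply: measurable_indic.
have -> : [set y : R | s * y <= v] = (fun y => s * y) @^-1` `]-oo, v].
  by apply/seteqP; split => y /=; rewrite in_itv.
rewrite -[X in measurable X]setTI.
by apply: measurable_funM => //; exact: measurable_itv.
Qed.

Lemma quartic_int_cvg c (b_ : nat -> R) b (g_ : nat -> R -> R) g A y0 : c < 0 ->
  b_ n @[n --> \oo] --> b ->
  (forall n, measurable_fun setT (g_ n)) -> measurable_fun setT g ->
  (forall n y, `|g_ n y| <= A * (1 + `|y|)) ->
  (forall y, y <> y0 -> g_ n y @[n --> \oo] --> g y) ->
  quartic_int c (b_ n) (g_ n) @[n --> \oo] --> quartic_int c b g.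
Proof.
move=> c0 bb mg_ mg gA gg.
have [B [_ /(_ (B + 1))]] : bounded_fun b_ by apply: cvg_seq_bounded; apply/cvg_ex; exists b.
rewrite ltrDl ltr01 => /(_ isT) b_B.
have [C C0 CP] := quartic_exp_gauss_bound (B + 1) c0.
have A0 : 0 <= A by have := le_trans (normr_ge0 _) (gA 0%N 0); rewrite normr0 addr0 mulr1.
apply: (@dominated_cvg_Rintegral _ _ _ (A * C) y0).
- by move=> n; apply: measurable_funM => //; exact: measurable_quartic_exp.
- by apply: measurable_funM => //; exact: measurable_quartic_exp.
- move=> y /gg gy; apply: cvgM => //.
  apply: (@cvg_comp _ _ _ (fun n => c * y ^+ 4 + b_ n * y) (@expR R)); last exact: continuous_expR.
  by apply: cvgD; [exact: cvg_cst|apply: cvgM => //; exact: cvg_cst].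
- move=> n y _; rewrite normrM (ger0_norm (expR_ge0 _)).
  apply: (@le_trans _ _ (A * (1 + `|y|) * quartic_exp c (b_ n) y)).
    by rewrite ler_wpM2r ?expR_ge0.
  by rewrite -!mulrA ler_wpM2l// CP//; exact: b_B.
Qed.

Lemma quartic_mean_cvg c (b_ : nat -> R) b : c < 0 -> b_ n @[n --> \oo] --> b ->
  quartic_mean c (b_ n) @[n --> \oo] --> quartic_mean c b.
Proof.
move=> c0 bb; apply: cvgM.
  apply: (@quartic_int_cvg _ _ _ (fun=> id) id 1 0) => //; last by move=> y _; exact: cvg_cst.
  by move=> _ y; rewrite mul1r lerDr.
apply: cvgV; first by rewrite gt_eqF// quartic_int_cst1_gt0.
apply: (@quartic_int_cvg _ _ _ (fun=> cst 1) (cst 1) 1 0) => //; last by move=> y _; exact: cvg_cst.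
by move=> _ y; rewrite mul1r normr1 lerDl.
Qed.

Lemma quartic_integrable_indic c b s v : c < 0 ->
  mu.-integrable setT (EFin \o (fun y => (\1_[set y : R | s * y <= v] : R -> R) y * quartic_exp c b y)).
Proof.
move=> c0; apply: (@quartic_integrable _ _ _ 1) => //; first exact: measurable_le_indic.
move=> y; rewrite mul1r indicE; case: (_ \in _); rewrite ?normr1 ?normr0 ?lerDl//.
Qed.

(** [s] enters twice, as the tilt per unit of [t] and as the slope of the power at [m]; hence the
    function is nondecreasing in [t] for either sign of [s]. *)
Definition limit_mean c s t : R := s * quartic_mean c (s * t).

Definition limit_cdf c s t : R :=
  quartic_int c 0 (\1_[set y : R | s * y <= limit_mean c s t]) / quartic_int c 0 (cst 1).

Lemma limit_mean_nondecreasing c s : c < 0 -> {homo limit_mean c s : t t' / t <= t'}.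
Proof.
move=> c0 t t' tt'; rewrite /limit_mean; have [s0|s0|->] := ltgtP s 0; last by rewrite !mul0r.
  by rewrite ler_nM2l// quartic_mean_nondecreasing// ler_nM2l.
by rewrite ler_pM2l// quartic_mean_nondecreasing// ler_pM2l.
Qed.

Lemma limit_mean_cvg c s (t_ : nat -> R) t : c < 0 -> t_ n @[n --> \oo] --> t ->
  limit_mean c s (t_ n) @[n --> \oo] --> limit_mean c s t.
Proof.
move=> c0 tt; apply: cvgM; first exact: cvg_cst.
by apply: quartic_mean_cvg => //; apply: cvgM => //; exact: cvg_cst.
Qed.

Lemma limit_mean_cvgy c s (t_ : nat -> R) : c < 0 -> s != 0 -> t_ n @[n --> \oo] --> +oo ->
  limit_mean c s (t_ n) @[n --> \oo] --> +oo.
Proof.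
move=> c0 s0 ty; apply/cvgryPge => K.
have [t0 t0K] := quartic_mean_unbounded K c0 s0.
by move/cvgryPge/(_ t0): ty; apply: filterS => n; exact: t0K.
Qed.

(** Changing the signs of [s], [t] and [K] keeps the tilt [s * t], so the bound for large positive
    [t] applies. *)
Lemma limit_mean_cvgNy c s (t_ : nat -> R) : c < 0 -> s != 0 -> t_ n @[n --> \oo] --> -oo ->
  limit_mean c s (t_ n) @[n --> \oo] --> -oo.
Proof.
move=> c0 s0 ty; apply/cvgrNyPle => K.
have Ns0 : - s != 0 by rewrite oppr_eq0.
have [t0 t0K] := quartic_mean_unbounded (- K) c0 Ns0.
move/cvgrNyPle/(_ (- t0)): ty; apply: filterS => n; rewrite lerNr => /t0K.
by rewrite mulrNN mulNr lerN2.
Qed.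

Lemma limit_cdf_cvg_aux c s (v_ : nat -> R) g y0 : c < 0 -> measurable_fun setT g ->
  (forall y, y <> y0 -> (\1_[set y : R | s * y <= v_ n] : R -> R) y @[n --> \oo] --> g y) ->
  quartic_int c 0 (\1_[set y : R | s * y <= v_ n]) / quartic_int c 0 (cst 1) @[n --> \oo] -->
  quartic_int c 0 g / quartic_int c 0 (cst 1).
Proof.
move=> c0 mg hg; apply: cvgM; last exact: cvg_cst.
apply: (@quartic_int_cvg _ _ _ _ _ 1 y0) => //.
- exact: cvg_cst.
- by move=> n; exact: measurable_le_indic.
- move=> n y; rewrite mul1r indicE; case: (_ \in _); rewrite ?normr1 ?normr0 ?lerDl//.
Qed.

Lemma limit_cdf_cvg c s (t_ : nat -> R) t : c < 0 -> s != 0 -> t_ n @[n --> \oo] --> t ->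
  limit_cdf c s (t_ n) @[n --> \oo] --> limit_cdf c s t.
Proof.
move=> c0 s0 tt; apply: (@limit_cdf_cvg_aux _ _ _ _ (limit_mean c s t / s)) => //.
  exact: measurable_le_indic.
move=> y yv; apply: cvg_near_cst.
have sy : s * y != limit_mean c s t.
  by apply/eqP => E; apply: yv; rewrite -E mulrC mulKf.
have cs : (fun=> s * y : R) n @[n --> \oo] --> s * y by exact: cvg_cst.
have := near_eq_le sy cs (@limit_mean_cvg c s t_ t c0 tt).
by apply: filterS => n [nE _]; rewrite !indic_leE nE.
Qed.

Lemma limit_cdf_cvgy c s (t_ : nat -> R) : c < 0 -> s != 0 -> t_ n @[n --> \oo] --> +oo ->
  limit_cdf c s (t_ n) @[n --> \oo] --> (1 : R).
Proof.
move=> c0 s0 ty.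
have <- : quartic_int c 0 (cst 1) / quartic_int c 0 (cst 1) = 1.
  by rewrite divff// gt_eqF// quartic_int_cst1_gt0.
apply: (@limit_cdf_cvg_aux _ _ _ _ 0) => // y _; apply: cvg_near_cst.
have := limit_mean_cvgy c0 s0 ty; move/cvgryPge/(_ (s * y)).
by apply: filterS => n h; rewrite indic_leE h.
Qed.

Lemma limit_cdf_cvgNy c s (t_ : nat -> R) : c < 0 -> s != 0 -> t_ n @[n --> \oo] --> -oo ->
  limit_cdf c s (t_ n) @[n --> \oo] --> (0 : R).
Proof.
move=> c0 s0 ty.
have <- : quartic_int c 0 (cst 0) / quartic_int c 0 (cst 1) = 0.
  by rewrite /quartic_int; under eq_Rintegral do rewrite mul0r; rewrite Rintegral_cst// !mul0r.
apply: (@limit_cdf_cvg_aux _ _ _ _ 0) => // y _; apply: cvg_near_cst.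
have := limit_mean_cvgNy c0 s0 ty; move/cvgrNyPlt/(_ (s * y)).
by apply: filterS => n h; rewrite indic_leE leNgt h.
Qed.

Lemma limit_cdf_nondecreasing c s : c < 0 -> {homo limit_cdf c s : t t' / t <= t'}.
Proof.
move=> c0 t t' tt'; have Z0 := quartic_int_cst1_gt0 0 c0.
apply: ler_wpM2r; first by rewrite invr_ge0 ltW.
apply: le_Rintegral => //; [exact: quartic_integrable_indic|exact: quartic_integrable_indic|].
move=> y _; apply: ler_wpM2r; first exact: expR_ge0.
by apply: indic_le_homo; exact: limit_mean_nondecreasing.
Qed.

(** The hypotheses are sequential because dominated convergence delivers limits along sequences. The
    witness is the Lebesgue-Stieltjes measure of [F]. *)
Lemma exists_probability_cdf (F : R -> R) : {homo F : x y / x <= y} ->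
  (forall u : nat -> R, forall x, u n @[n --> \oo] --> x -> F (u n) @[n --> \oo] --> F x) ->
  (forall u : nat -> R, u n @[n --> \oo] --> -oo -> F (u n) @[n --> \oo] --> (0 : R)) ->
  (forall u : nat -> R, u n @[n --> \oo] --> +oo -> F (u n) @[n --> \oo] --> (1 : R)) ->
  exists P : probability (measurableTypeR R) R, forall t, distribution_function P t = F t.
Proof.
move=> Fnd Fc FNy Fy.
have Frc : right_continuous F.
  by move=> x; apply/cvg_at_rightP => u [_ ux]; exact: Fc.
have FNy0 : F @ -oo --> (0 : R) by apply/cvg_ninftyP.
have Fy1 : F @ +oo --> (1 : R) by apply/cvg_pinftyP.
pose m1 := isCumulative.Build R _ R F Fnd Frc.
pose m2 := isCumulativeBounded.Build R 0 1 F FNy0 Fy1.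
pose F' : cumulativeBounded 0 1 := HB.pack F m1 m2.
exists (lebesgue_stieltjes_measure F') => t.
have := cdf_lebesgue_stieltjes_id F' t.
rewrite /cdf /distribution /pushforward/= preimage_id => h.
by rewrite /distribution_function h.
Qed.

End Quartic_integrals.

(** * Integration and distribution functions under the quartic law *)

Section Quartic_law.
Context {R : realType}.
Local Notation mu := (@lebesgue_measure R).
Implicit Types (b c s t x y : R).

Lemma quartic_lawT c b : c < 0 -> quartic_law c b setT = 1%E.
Proof.
move=> c0; rewrite /quartic_law.
have Z0 := quartic_int_cst1_gt0 b c0; rewrite quartic_int_cst1 in Z0.
have iq : mu.-integrable setT (EFin \o quartic_exp c b).
  have := quartic_integrable_cst1 b c0.
  by apply: eq_integrable => // y _ /=; rewrite mul1r.
under eq_integral do rewrite EFinM.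
rewrite integralZr// -(fineK (integrable_fin_num measurableT iq)) -EFinM.
by rewrite divff// gt_eqF.
Qed.

(** The law is dominated by Lebesgue measure, and its Radon-Nikodym derivative agrees almost
    everywhere with [quartic_pdf], both having the same integrals over measurable sets. *)
Lemma integral_quartic_law_ge0 c b (f : measurableTypeR R -> \bar R) : c < 0 ->
  measurable_fun setT f -> (forall x, (0 <= f x)%E) ->
  (\int[quartic_law c b]_x f x = \int[mu]_x (f x * (quartic_pdf c b x)%:E))%E.
Proof.
move=> c0 mf f0.
have mq : measurable_fun setT (fun x : R => (quartic_pdf c b x)%:E).
  by apply/measurable_EFinP; exact: measurable_quartic_pdf.
pose nu : probability (measurableTypeR R) R := HB.pack (Measure.sort (quartic_law c b))
  (Measure_isProbability.Build _ _ _ (quartic_law c b) (quartic_lawT b c0)).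
have nu_mu : nu `<< mu.
  apply/null_content_dominatesP => A mA muA0; apply: null_set_integral => //.
  exact: measurable_funTS.
rewrite -[LHS](Radon_Nikodym_SigmaFinite.change_of_variables nu_mu)//.
have iRN := Radon_Nikodym_SigmaFinite.f_integrable nu_mu.
apply: ae_eq_integral => //.
- by apply: emeasurable_funM => //; exact: measurable_int iRN.
- exact: emeasurable_funM.
apply: ae_eqe_mul2l; apply: integral_ae_eq => // A _ mA.
exact/esym/(Radon_Nikodym_SigmaFinite.f_integral nu_mu).
Qed.

Lemma Rintegral_quartic_law c b : c < 0 ->
  (\int[quartic_law c b]_x x)%R = quartic_mean c b.
Proof.
move=> c0.
have mid : measurable_fun setT (EFin : R -> \bar R) by exact/measurable_EFinP.
(* The change of variables is for nonnegative functions, so positive and negative parts are treated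
   separately. *)
rewrite /Rintegral integralE !integral_quartic_law_ge0//=; last 2 first.
  exact: measurable_funeneg.
  exact: measurable_funepos.
have q0 x : 0 <= quartic_pdf c b x by exact: quartic_pdf_ge0.
transitivity (\int[mu]_x (x * quartic_pdf c b x))%R.
  rewrite /Rintegral [in RHS]integralE; congr (fine (_ - _)%E).
    apply: eq_integral => x _.
    by rewrite !funeposE -!EFin_max -EFinM maxr_pMl// mul0r.
  apply: eq_integral => x _.
  by rewrite !funenegE -!EFinN -!EFin_max -EFinM maxr_pMl// mul0r mulNr.
rewrite /quartic_mean quartic_int_cst1 /quartic_int -RintegralZr//.
  by apply: eq_Rintegral => x _; rewrite mulrA.
exact: quartic_integrable_id.
Qed.

Lemma distribution_function_quartic_law c b x : c < 0 ->
  distribution_function (quartic_law c b) x =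
  quartic_int c b (\1_[set y : R | 1 * y <= x]) / quartic_int c b (cst 1).
Proof.
move=> c0; rewrite /distribution_function /quartic_law integral_mkcond.
rewrite quartic_int_cst1 /quartic_int -RintegralZr//; last exact: quartic_integrable_indic.
congr fine; apply: eq_integral => y _; rewrite restrict_EFin /=; congr EFin.
rewrite patchE indic_leE mul1r; have [yx|yx] := leP y x.
  by rewrite mem_set ?mul1r//= in_itv.
by rewrite memNset ?mul0r//= in_itv/=; apply/negP; rewrite -ltNge.
Qed.

Lemma limit_cdf_pos c s t : c < 0 -> 0 < s ->
  limit_cdf c s t = distribution_function (quartic_law c 0) (quartic_mean c (s * t)).
Proof.
move=> c0 s0; rewrite distribution_function_quartic_law// /limit_cdf.
congr (quartic_int _ _ (\1_ _) / _); apply/seteqP.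
by split => y /=; rewrite /limit_mean mul1r ler_pM2l.
Qed.

(** Dividing by [s] turns the event into [u <= y]; together with [y <= u] it covers the line, with
    overlap the null set [{u}]. *)
Lemma limit_cdf_neg c s t : c < 0 -> s < 0 ->
  limit_cdf c s t = 1 - distribution_function (quartic_law c 0) (quartic_mean c (s * t)).
Proof.
move=> c0 s0; rewrite distribution_function_quartic_law// /limit_cdf.
set u := quartic_mean c (s * t).
have Z0 := quartic_int_cst1_gt0 0 c0.
suff E : quartic_int c 0 (\1_[set y : R | s * y <= limit_mean c s t]) +
    quartic_int c 0 (\1_[set y : R | 1 * y <= u]) = quartic_int c 0 (cst 1).
  by apply/eqP; rewrite eq_sym subr_eq -mulrDl E divff// (gt_eqF Z0).
rewrite /quartic_int -RintegralD//; try exact: quartic_integrable_indic.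
congr fine; apply: ae_eq_integral => //.
- apply/measurable_EFinP; apply: measurable_funD; apply: measurable_funM;
    (exact: measurable_le_indic || exact: measurable_quartic_exp).
- by apply/measurable_EFinP; apply: measurable_funM => //; exact: measurable_quartic_exp.
exists [set u]; split => //; first exact: lebesgue_measure_set1.
move=> y /= yE; apply: contrapT => yu; apply: yE => _.
rewrite -mulrDl; congr (_ * _)%:E; rewrite !indic_leE mul1r /limit_mean ler_nM2l//.
by move/eqP: yu; rewrite neq_lt => /orP[] yu; rewrite (ltW yu) leNgt yu ?addr0 ?add0r.
Qed.

End Quartic_law.

(** * Rescaled weights of the magnetization *)

Section Magnetization_levels.
Context {R : realType}.
Implicit Types (N k p : nat) (beta h m t x : R).

(* [k] spins equal to -1. *)
Definition level N k : R := (N%:R - 2 * k%:R) / N%:R.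

Definition config_of_set N (A : {set 'I_N}) : config N := [ffun i => i \in A].

Lemma magnetization_config_of_set N (A : {set 'I_N}) :
  magnetization (config_of_set A) = level N #|A| :> R.
Proof.
rewrite /magnetization /level mulrC; congr (_ / _).
transitivity (\sum_(i < N) (1 - 2 * (i \in A)%:R) : R).
  by apply: eq_bigr => i _; rewrite /spin ffunE; case: (_ \in _); rewrite /= ?mulr1n ?mulr0n ?expr1 ?expr0; lra.
rewrite sumrB -mulr_sumr -natr_sum sumr_const card_ord; congr (_ - _ * _%:R).
by rewrite -sum1_card [RHS]big_mkcond; apply: eq_bigr => i _; case: (_ \in _).
Qed.

Lemma config_of_set_bij N : bijective (@config_of_set N).
Proof.
exists (fun s : config N => [set i | s i]%SET) => [A|s].
  by apply/setP => i; rewrite inE ffunE.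
by apply/ffunP => i; rewrite ffunE inE.
Qed.

Lemma sum_magnetization N (F : R -> R) :
  \sum_(s : config N) F (magnetization s) = \sum_(k < N.+1) 'C(N, k)%:R * F (level N k).
Proof.
rewrite (reindex (@config_of_set N)) /=; last exact/onW_bij/config_of_set_bij.
rewrite (partition_big (fun A : {set 'I_N} => inord #|A| : 'I_N.+1) xpredT)//=.
apply: eq_bigr => k _.
rewrite (eq_bigr (fun=> F (level N k))); last first.
  move=> A /eqP <-; rewrite magnetization_config_of_set inordK//.
  by rewrite ltnS (leq_trans (max_card _))// card_ord.
rewrite (eq_bigl (fun A => A \in [set B : {set 'I_N} | #|B| == k]%SET)).
  by rewrite sumr_const card_draws card_ord mulr_natl.
move=> A; rewrite inE -val_eqE /= inordK//.
by rewrite ltnS (leq_trans (max_card _))// card_ord.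
Qed.

Definition log_binomial_prefactor N k : R :=
  log_stirling N - log_stirling k - log_stirling (N - k)
  + (ln N.+1%:R - ln k.+1%:R - ln (N - k).+1%:R) / 2.

(** An identity rather than an estimate: [log_stirling] is the exact logarithmic error, and the
    linear terms cancel because [N = k + (N - k)]. *)
Lemma binomial_entropy N k : (0 < N)%N -> (k <= N)%N -> 'C(N, k)%:R =
  expR (log_binomial_prefactor N k + N%:R * ln 2 - N%:R * entropy (level N k)) :> R.
Proof.
move=> N0 kN; have N0' : 0 < N%:R :> R by rewrite ltr0n.
have C0 : 0 < 'C(N, k)%:R :> R by rewrite ltr0n bin_gt0.
rewrite -[LHS]lnK ?posrE//; congr expR.
have : ln ('C(N, k)%:R * (k`!%:R * (N - k)`!%:R)) = ln N`!%:R :> R.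
  by rewrite -!natrM bin_fact.
have fact_pos j : (j`!%:R : R) \is Num.pos by rewrite posrE ltr0n fact_gt0.
have C_pos : ('C(N, k)%:R : R) \is Num.pos by rewrite posrE.
rewrite lnM ?rpredM// lnM//.
(* At [j = 0] the factor annihilates the logarithm, so the extreme levels -1 and 1 are covered. *)
have xlnx j : j%:R * ln (2 * (j%:R / N%:R)) = j%:R * (ln 2 + ln j%:R - ln N%:R) :> R.
  case: j => [|j]; first by rewrite !mul0r.
  by rewrite lnM ?posrE ?divr_gt0 ?ltr0n// ln_div ?posrE ?ltr0n// addrA.
have -> : N%:R * entropy (level N k) =
    (N - k)%:R * ln (2 * ((N - k)%:R / N%:R)) + k%:R * ln (2 * (k%:R / N%:R)).
  rewrite /entropy /level natrB//.
  have -> : 1 + (N%:R - 2 * k%:R) / N%:R = 2 * ((N%:R - k%:R) / N%:R) :> R by field; lra.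
  have -> : 1 - (N%:R - 2 * k%:R) / N%:R = 2 * (k%:R / N%:R) :> R by field; lra.
  by field; lra.
rewrite !xlnx /log_binomial_prefactor /log_stirling natrB//.
set a := ln (N%:R - k%:R); set b := ln k%:R; set d := ln N%:R.
set fN := ln N`!%:R; set fk := ln k`!%:R; set fNk := ln (N - k)`!%:R.
set aS := ln (N - k).+1%:R; set bS := ln k.+1%:R; set dS := ln N.+1%:R.
move=> E; have -> : ln 'C(N, k)%:R = fN - fk - fNk by rewrite -E; ring.
by field.
Qed.

(* The factors independent of [k] are chosen such that the weights converge at
   levels at distance of order [N `^ (- (1 / 4))] from [m]. *)
Definition scaled_weight p beta h m t N k : R :=
  expR (log_binomial_prefactor N k + ln N%:R / 2 +
    N%:R * (Hfun beta h p (level N k) - Hfun beta h p m) +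
    t * N%:R `^ (1 / 4) * (level N k ^+ p - m ^+ p)).

Lemma powR14 N n : (N%:R `^ (1 / 4)) ^+ n = N%:R `^ (n%:R / 4) :> R.
Proof. by rewrite -powR_mulrn ?powR_ge0// -powRrM mulrC mulrA mulr1. Qed.

Lemma powR14_4 N : (N%:R `^ (1 / 4)) ^+ 4 = N%:R :> R.
Proof. by rewrite powR14 divff// powRr1. Qed.

Lemma mulN_div_powR34 t N : (0 < N)%N ->
  N%:R * (t / N%:R `^ (3 / 4)) = t * N%:R `^ (1 / 4) :> R.
Proof.
move=> N0; have r0 : 0 < N%:R `^ (1 / 4) :> R by rewrite powR_gt0 // ltr0n.
rewrite -powR14; move: (powR14_4 N) r0; move: (_ `^ _) => r <- r0.
by field; rewrite gt_eqF.
Qed.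

Lemma gibbs_expectation_scaled p beta h m t N (F : R -> R) : (0 < N)%N ->
  gibbs_expectation (beta + t / N%:R `^ (3 / 4)) h p (fun s : config N => F (magnetization s)) =
  (\sum_(k < N.+1) scaled_weight p beta h m t N k * F (level N k)) /
  (\sum_(k < N.+1) scaled_weight p beta h m t N k).
Proof.
move=> N0; set b := beta + _.
have N0' : 0 < N%:R :> R by rewrite ltr0n.
pose K := expR (ln N%:R / 2 - N%:R * ln 2 - N%:R * Hfun beta h p m - t * N%:R `^ (1 / 4) * m ^+ p).
pose gw x := expR (N%:R * (b * x ^+ p + h * x)).
have wE (k : 'I_N.+1) : scaled_weight p beta h m t N k = K * ('C(N, k)%:R * gw (level N k)).
  rewrite binomial_entropy//; last by rewrite -ltnS.
  rewrite /K /gw -!expRD /scaled_weight; congr expR.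
  have -> : N%:R * (b * level N k ^+ p + h * level N k) =
      N%:R * (beta * level N k ^+ p + h * level N k) + t * N%:R `^ (1 / 4) * level N k ^+ p.
    by rewrite /b -(mulN_div_powR34 t N0); ring.
  by rewrite {1}/Hfun; ring.
have K0 : K != 0 by rewrite gt_eqF// expR_gt0.
rewrite (eq_bigr (fun k : 'I_N.+1 => K * ('C(N, k)%:R * (gw (level N k) * F (level N k))))); last first.
  by move=> k _; rewrite wE !mulrA.
rewrite -mulr_sumr -(sum_magnetization N (fun x => gw x * F x)).
have -> : \sum_(k < N.+1) scaled_weight p beta h m t N k =
    K * \sum_(s : config N) gw (magnetization s).
  by rewrite sum_magnetization mulr_sumr; apply: eq_bigr => k _.
rewrite -mulf_div divff// mul1r mulr_suml /gibbs_expectation; apply: eq_bigr => s _.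
by rewrite gibbsE mulrAC.
Qed.

End Magnetization_levels.

(** * Step functions on a grid *)

Section Step_function.
Context {R : realType}.
Local Notation mu := (@lebesgue_measure R).
Context (y0 d : R) (d0 : 0 < d).
Implicit Types (a : nat -> R) (k n : nat) (y : R).

(** Cells go leftwards because levels decrease in [k]: with [y0] the rescaled level 1 and [d] the
    mesh, the right end point of cell [k] is the rescaled level of [k]. *)
Definition cell k : set R := `]y0 - k.+1%:R * d, y0 - k%:R * d]%classic.

Definition step_fun n a y : R := \sum_(k < n) a k * \1_(cell k) y.

Lemma mem_cell k y : (y \in cell k) = (k%:R <= (y0 - y) / d < k.+1%:R).
Proof.
rewrite ler_pdivlMr// ltr_pdivrMr//; apply/idP/idP.
  by rewrite inE /cell/= in_itv/=; lra.
by move=> h; rewrite inE /cell/= in_itv/=; lra.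
Qed.

Lemma mem_cell_inj k j y : y \in cell k -> y \in cell j -> k = j.
Proof.
rewrite !mem_cell => /andP[k1 k2] /andP[j1 j2]; apply/eqP; rewrite eqn_leq.
have := le_lt_trans k1 j2; have := le_lt_trans j1 k2.
by rewrite !ltr_nat => jk kj; apply/andP; split.
Qed.

Lemma step_fun_cell n a k y : (k < n)%N -> y \in cell k -> step_fun n a y = a k.
Proof.
move=> kn yk; rewrite /step_fun (bigD1 (Ordinal kn))//= indicE yk mulr1 big1 ?addr0// => j jk.
rewrite indicE; have [yj|] := boolP (y \in cell j); last by rewrite mulr0.
by move: jk; rewrite -val_eqE /= (mem_cell_inj yk yj) eqxx.
Qed.

Lemma step_fun_cases n a y :
  step_fun n a y = 0 \/ exists k, [/\ (k < n)%N, y \in cell k & step_fun n a y = a k].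
Proof.
have [/existsP[k yk]|/existsPn h] := boolP [exists k : 'I_n, y \in cell k].
  by right; exists k; split => //; exact: step_fun_cell.
by left; rewrite /step_fun big1// => k _; rewrite indicE (negbTE (h k)) mulr0.
Qed.

Lemma measurable_cell k : measurable (cell k).
Proof. exact: measurable_itv. Qed.

Lemma measurable_step_fun n a : measurable_fun setT (step_fun n a).
Proof.
apply: measurable_sum => k; apply: measurable_funM => //.
by apply: measurable_indic; exact: measurable_cell.
Qed.

Lemma lebesgue_measure_cell k : mu (cell k) = d%:E.
Proof.
have d1 := d0; rewrite lebesgue_measure_itv/= lte_fin -natr1 mulrDl mul1r ifT; last by lra.
by rewrite -EFinD; congr EFin; lra.
Qed.

Lemma integral_cell k : (\int[mu]_y (\1_(cell k) y)%:E)%E = d%:E.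
Proof.
have mk := measurable_cell k.
by rewrite integral_indic// setIT; exact: lebesgue_measure_cell.
Qed.

Lemma integrable_cell k : mu.-integrable setT (EFin \o (\1_(cell k) : R -> R)).
Proof.
apply/integrableP; split.
  by apply/measurable_EFinP/measurable_indic; exact: measurable_cell.
under eq_integral do rewrite /= ger0_norm//.
by rewrite [X in (X < _)%E](_ : _ = d%:E) ?ltry//; exact: integral_cell.
Qed.

Lemma Rintegral_step_fun n a : (\int[mu]_y step_fun n a y)%R = d * \sum_(k < n) a k.
Proof.
rewrite /Rintegral /step_fun.
under eq_integral do rewrite -sumEFin.
rewrite integral_sum//; last first.
  move=> k; exact: (integrableZl measurableT (a k) (integrable_cell k)).
rewrite (eq_bigr (fun k : 'I_n => (d * a k)%:E)).
  by rewrite sumEFin /= mulr_sumr.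
move=> k _; under eq_integral do rewrite EFinM.
rewrite integralZl//; last exact: integrable_cell.
by rewrite mulrC EFinM; congr (_ * _)%E; exact: integral_cell.
Qed.

End Step_function.

(** * Uniform bounds on the weights *)

Section Scaled_weight.
Context {R : realType}.
Implicit Types (N k p : nat) (beta h m t x y e c B : R).

Definition rescale m N x : R := N%:R `^ (1 / 4) * (x - m).

Lemma rescale4 m N x : rescale m N x ^+ 4 = N%:R * (x - m) ^+ 4.
Proof. by rewrite exprMn powR14_4. Qed.

Lemma levelE N k : (0 < N)%N -> (k <= N)%N ->
  k%:R / N%:R = (1 - level N k) / 2 :> R /\ (N - k)%:R / N%:R = (1 + level N k) / 2 :> R.
Proof.
move=> N0 kN; have N0' : 0 < N%:R :> R by rewrite ltr0n.
by rewrite /level natrB//; split; field; lra.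
Qed.

Lemma level_itv N k : (0 < N)%N -> (k <= N)%N -> -1 <= (level N k : R) <= 1.
Proof.
move=> N0 kN; have [E1 E2] := @levelE N k N0 kN.
have : 0 <= k%:R / N%:R :> R by rewrite divr_ge0.
have : 0 <= (N - k)%:R / N%:R :> R by rewrite divr_ge0.
by rewrite E1 E2; lra.
Qed.

Lemma norm_subrXX_le x m p : `|x| <= 1 -> `|m| <= 1 -> `|x ^+ p - m ^+ p| <= p%:R * `|x - m|.
Proof.
move=> x1 m1; rewrite subrXX normrM mulrC ler_wpM2r//.
apply: le_trans (ler_norm_sum _ _ _) _.
apply: (@le_trans _ _ (\sum_(i < p) 1)); last by rewrite sumr_const card_ord.
apply: ler_sum => i _; rewrite normrM !normrX.
by rewrite mulr_ile1 ?exprn_ge0// exprn_ile1.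
Qed.

(* Near [m] the prefactor is bounded. Elsewhere it is at most logarithmic in [N],
   hence dominated by the quartic term, which is of order [N] there. *)
Lemma log_binomial_prefactor_bound m c : -1 < m -> m < 1 -> 0 < c ->
  exists B : R, forall N k, (0 < N)%N -> (k <= N)%N ->
    log_binomial_prefactor N k + ln N%:R / 2 <= B + c * rescale m N (level N k) ^+ 4.
Proof.
move=> m_gt m_lt c0; have m1 : `|m| < 1 by rewrite ltr_norml m_gt.
(* [|x - m| < d] forces [k/N] and [(N - k)/N] above [a]; [q N / 2] is the quartic term at distance
   [d]. *)
pose a : R := (1 - `|m|) / 4; pose d : R := (1 - `|m|) / 2; pose q : R := 2 * c * d ^+ 4.
have a0 : 0 < a by rewrite /a; lra.
have d0 : 0 < d by rewrite /d; lra.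
have q0 : 0 < q by rewrite /q mulr_gt0 ?exprn_gt0// mulr_gt0.
(* The constants of the near case and of the far case. *)
exists (Num.max (3 / 2 - ln a) (1 - ln q / 2)) => N k N0 kN.
have N0' : 0 < N%:R :> R by rewrite ltr0n.
have [E1 E2] := @levelE N k N0 kN.
have lsN := @log_stirling_le1 R N.
have lsk := @log_stirling_ge0 R k.
have lsNk := @log_stirling_ge0 R (N - k).
rewrite rescale4 /log_binomial_prefactor; set x := level N k.
have y0 : 0 <= c * (N%:R * (x - m) ^+ 4).
  by apply: mulr_ge0 (ltW c0) _; apply: mulr_ge0 => //; exact: exprn_even_ge0.
have [near|far] := ltP `|x - m| d.
  have ln_ge j : a <= j%:R / N%:R -> ln a + ln N%:R <= ln j.+1%:R.
    rewrite ler_pdivlMr// => aj.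
    have aN : a * N%:R \is Num.pos by rewrite posrE; exact: mulr_gt0.
    have jS : (j.+1%:R : R) \is Num.pos by rewrite posrE.
    rewrite -lnM// ler_ln//.
    by rewrite (le_trans aj)// ler_nat.
  have x_m : `|x| <= `|x - m| + `|m| by rewrite -[X in `|X| <= _](subrK m) ler_normD.
  have /ln_ge h1 : a <= k%:R / N%:R.
    by rewrite E1 -/x; have := ler_norm x; rewrite /a /d in near *; lra.
  have /ln_ge h2 : a <= (N - k)%:R / N%:R.
    by rewrite E2 -/x; have := ler_norm (- x); rewrite normrN /a /d in near *; lra.
  have h3 : ln N.+1%:R <= ln N%:R + 1 :> R.
    rewrite lnS// lerD2l; apply: le_trans (le_ln1Dx _) _.
      by rewrite (lt_le_trans (ltrN10 R))// invr_ge0 ltW.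
    by rewrite invf_le1// ler1n.
  have : 3 / 2 - ln a <= Num.max (3 / 2 - ln a) (1 - ln q / 2) by rewrite le_max lexx.
  by lra.
have h1 : ln N.+1%:R <= ln k.+1%:R + ln (N - k).+1%:R :> R.
  rewrite -lnM ?posrE// -natrM ler_ln ?posrE ?ltr0n ?muln_gt0// ler_nat.
  by rewrite mulSn mulnS addnA addSn subnK// leq_addr.
have h2 : ln N%:R <= q * N%:R - ln q.
  have := ltW (ln_sublinear (mulr_gt0 q0 N0')).
  by rewrite lnM ?posrE//; lra.
have h3 : q / 2 * N%:R <= c * (N%:R * (x - m) ^+ 4).
  have -> : q / 2 * N%:R = c * (N%:R * d ^+ 4) by rewrite /q; field.
  rewrite ler_pM2l// ler_pM2l//.
  have -> : (x - m) ^+ 4 = `|x - m| ^+ 4 by rewrite -normrX ger0_norm// exprn_even_ge0.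
  by rewrite lerXn2r ?nnegrE// ltW.
have : 1 - ln q / 2 <= Num.max (3 / 2 - ln a) (1 - ln q / 2) by rewrite le_max lexx orbT.
by lra.
Qed.

(** Half of the decay [k0] pays for the binomial prefactor. The tilt is at most linear because the
    power is Lipschitz on [-1, 1]. *)
Lemma scaled_weight_bound p beta h m t (k0 : R) : -1 < m -> m < 1 -> 0 < k0 ->
  (forall x, x \in `[-1, 1] ->
    Hfun beta h p x - Hfun beta h p m <= - k0 * (x - m) ^+ 4) ->
  exists B : R, forall N k, (0 < N)%N -> (k <= N)%N ->
    scaled_weight p beta h m t N k <=
    expR (B - k0 / 2 * rescale m N (level N k) ^+ 4 +
          `|t| * p%:R * `|rescale m N (level N k)|).
Proof.
move=> m_gt m_lt k00 Hk; have k02 : 0 < k0 / 2 by rewrite divr_gt0.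
have [B BP] := log_binomial_prefactor_bound m_gt m_lt k02.
exists B => N k N0 kN; rewrite ler_expR.
have x1 := @level_itv N k N0 kN; set x := level N k in x1 *.
have /Hk h1 : x \in `[-1, 1] by rewrite in_itv.
have h2 := BP _ _ N0 kN; rewrite -/x in h2.
have h3 : N%:R * (Hfun beta h p x - Hfun beta h p m) <= - k0 * rescale m N x ^+ 4.
  by rewrite rescale4 mulrCA ler_wpM2l.
have h4 : t * N%:R `^ (1 / 4) * (x ^+ p - m ^+ p) <= `|t| * p%:R * `|rescale m N x|.
  apply: le_trans (ler_norm _) _; rewrite /rescale !normrM -!mulrA ler_wpM2l//.
  rewrite mulrCA ler_wpM2l// norm_subrXX_le// ler_norml; first exact: x1.
  by rewrite !ltW.
by lra.
Qed.

End Scaled_weight.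

(** * Pointwise limits of the weights *)

Section Scaled_weight_limit.
Context {R : realType}.
Implicit Types (N k p : nat) (beta h m t x y e c l : R).

Lemma powR14_cvgy : (N%:R : R) `^ (1 / 4) @[N --> \oo] --> +oo.
Proof.
apply/cvgryPge => A; near=> N.
have [A0|A0] := leP A 0; first by rewrite (le_trans A0)// powR_ge0.
have AN : A ^+ 4 <= N%:R by near: N; exact: nbhs_infty_ger.
rewrite leNgt; apply/negP => NA; move: AN; rewrite leNgt => /negP; apply.
by rewrite -(powR14_4 N) ltrXn2r// ?nnegrE ?powR_ge0// ltW.
Unshelve. all: by end_near. Qed.

Lemma rescale_cvg_base m (x_ : nat -> R) y :
  rescale m N (x_ N) @[N --> \oo] --> y -> x_ N @[N --> \oo] --> m.
Proof.
move=> xy.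
have rV : ((N%:R : R) `^ (1 / 4))^-1 @[N --> \oo] --> (0 : R).
  apply/gtr0_cvgV0; last exact: powR14_cvgy.
  by near=> N; rewrite powR_gt0// ltr0n; near: N; exact: nbhs_infty_gt.
have h : ((N%:R : R) `^ (1 / 4))^-1 * rescale m N (x_ N) + m @[N --> \oo] --> 0 * y + m.
  by apply: cvgD; [exact: cvgM|exact: cvg_cst].
rewrite mul0r add0r in h; apply: cvg_trans h; apply: near_eq_cvg; near=> N.
rewrite /rescale mulKf ?subrK// gt_eqF// powR_gt0// ltr0n.
by near: N; exact: nbhs_infty_gt.
Unshelve. all: by end_near. Qed.

Lemma invn_cvg0 : (N%:R)^-1 @[N --> \oo] --> (0 : R).
Proof.
apply/gtr0_cvgV0; last exact: cvgr_idn.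
by near=> N; rewrite ltr0n; near: N; exact: nbhs_infty_gt.
Unshelve. all: by end_near. Qed.

Lemma nat_fraction_cvgy (j_ : nat -> nat) (a : R) : 0 < a ->
  (j_ N)%:R / N%:R @[N --> \oo] --> a -> j_ N @[N --> \oo] --> \oo.
Proof.
move=> a0 ja; apply/cvgnyPge => A.
have a2 : 0 < a / 2 by rewrite divr_gt0.
move/cvgrPdist_lt/(_ _ a2): ja => ja; near=> N.
have N0 : 0 < N%:R :> R by rewrite ltr0n; near: N; exact: nbhs_infty_gt.
have : `|a - (j_ N)%:R / N%:R| < a / 2 by near: N.
rewrite ltr_norml => /andP[_ h].
have {h} h : a / 2 * N%:R <= (j_ N)%:R by rewrite -ler_pdivlMr//; lra.
rewrite -(ler_nat R); apply: le_trans h; rewrite -ler_pdivrMl//.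
by near: N; exact: nbhs_infty_ger.
Unshelve. all: by end_near. Qed.

Lemma log_fraction_cvg (j_ : nat -> nat) (a : R) : 0 < a ->
  (j_ N)%:R / N%:R @[N --> \oo] --> a -> ln ((j_ N).+1%:R / N%:R : R) @[N --> \oo] --> ln a.
Proof.
move=> a0 ja.
apply: (@cvg_comp _ _ _ (fun N => (j_ N).+1%:R / N%:R : R) (@ln R)); last exact: continuous_ln.
have -> : (fun N => (j_ N).+1%:R / N%:R : R) = (fun N => (j_ N)%:R / N%:R + N%:R^-1).
  by apply/funext => N; rewrite -natr1 mulrDl mul1r.
have := cvgD ja invn_cvg0; rewrite addr0; exact.
Qed.

(** The numbers of spins of both signs are asymptotically positive fractions of [N], so all three
    Stirling terms tend to [l]. *)
Lemma log_binomial_prefactor_cvg m l (k_ : nat -> nat) y : -1 < m -> m < 1 ->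
  @log_stirling R n @[n --> \oo] --> l ->
  (forall N, (k_ N <= N)%N) -> rescale m N (level N (k_ N)) @[N --> \oo] --> y ->
  log_binomial_prefactor N (k_ N) + ln (N%:R : R) / 2 @[N --> \oo] -->
    - l - (ln ((1 - m) / 2) + ln ((1 + m) / 2)) / 2.
Proof.
move=> m_gt m_lt ls kN ky.
have xm := rescale_cvg_base ky.
have am : 0 < (1 - m) / 2 by lra.
have bm : 0 < (1 + m) / 2 by lra.
have ka : (k_ N)%:R / N%:R @[N --> \oo] --> (1 - m) / 2.
  have : (1 - level N (k_ N)) / 2 @[N --> \oo] --> (1 - m) / 2.
    by apply: cvgM; [apply: cvgB => //; exact: cvg_cst|exact: cvg_cst].
  apply: cvg_trans; apply: near_eq_cvg; near=> N.
  have N0 : (0 < N)%N by near: N; exact: nbhs_infty_gt.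
  by rewrite -(@levelE R N (k_ N) N0 (kN N)).1.
have kb : (N - k_ N)%:R / N%:R @[N --> \oo] --> (1 + m) / 2.
  have : (1 + level N (k_ N)) / 2 @[N --> \oo] --> (1 + m) / 2.
    by apply: cvgM; [apply: cvgD => //; exact: cvg_cst|exact: cvg_cst].
  apply: cvg_trans; apply: near_eq_cvg; near=> N.
  have N0 : (0 < N)%N by near: N; exact: nbhs_infty_gt.
  by rewrite -(@levelE R N (k_ N) N0 (kN N)).2.
have k1 : N%:R / N%:R @[N --> \oo] --> (1 : R).
  apply: cvg_near_cst; near=> N; rewrite divff// pnatr_eq0 -lt0n.
  by near: N; exact: nbhs_infty_gt.
have lk : log_stirling (k_ N) @[N --> \oo] --> l.
  by apply: (@cvg_comp _ _ _ k_ (@log_stirling R)) ls; exact: nat_fraction_cvgy am ka.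
have lNk : log_stirling (N - k_ N) @[N --> \oo] --> l.
  by apply: (@cvg_comp _ _ _ (fun N => N - k_ N)%N (@log_stirling R)) ls; exact: nat_fraction_cvgy bm kb.
(* Taking the three logarithms relative to [ln N] produces exactly the summand [ln N / 2]. *)
have H : (log_stirling N - log_stirling (k_ N) - log_stirling (N - k_ N)) +
   (ln (N.+1%:R / N%:R) - ln ((k_ N).+1%:R / N%:R) - ln ((N - k_ N).+1%:R / N%:R)) / 2
   @[N --> \oo] --> (l - l - l) + (ln 1 - ln ((1 - m) / 2) - ln ((1 + m) / 2)) / 2.
  apply: cvgD; first by apply: cvgB => //; exact: cvgB.
  apply: cvgM; last exact: cvg_cst.
  apply: cvgB; last exact: log_fraction_cvg bm kb.
  by apply: cvgB; [exact: log_fraction_cvg k1|exact: log_fraction_cvg am ka].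
have -> : - l - (ln ((1 - m) / 2) + ln ((1 + m) / 2)) / 2 =
  (l - l - l) + (ln 1 - ln ((1 - m) / 2) - ln ((1 + m) / 2)) / 2 by rewrite ln1; lra.
apply: cvg_trans H; apply: near_eq_cvg; near=> N.
have N0 : (N%:R : R) \is Num.pos by rewrite posrE ltr0n; near: N; exact: nbhs_infty_gt.
have jS j : (j.+1%:R : R) \is Num.pos by rewrite posrE.
by rewrite !ln_div// /log_binomial_prefactor; lra.
Unshelve. all: by end_near. Qed.

Lemma scaled_Hfun_cvg p beta h m c (x_ : nat -> R) y :
  (forall e, 0 < e -> exists2 d : R, 0 < d & forall x, `|x - m| < d ->
    `|Hfun beta h p x - Hfun beta h p m - c * (x - m) ^+ 4| <= e * (x - m) ^+ 4) ->
  rescale m N (x_ N) @[N --> \oo] --> y ->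
  N%:R * (Hfun beta h p (x_ N) - Hfun beta h p m) @[N --> \oo] --> c * y ^+ 4.
Proof.
move=> He xy; have xm := rescale_cvg_base xy.
have y4 : rescale m N (x_ N) ^+ 4 @[N --> \oo] --> y ^+ 4.
  by apply: (@cvg_comp _ _ _ (fun N => rescale m N (x_ N)) (fun z => z ^+ 4)) xy _; exact: exprn_continuous.
apply/cvgrPdist_le => e e0.
(* [q] eventually bounds [N (x - m)^4], and [M] below is a positive bound of [|c|]; the Taylor
   remainder and the error in the fourth power each take [e / 2]. *)
pose q := y ^+ 4 + 1.
have q0 : 0 < q by rewrite ltr_wpDl// exprn_even_ge0.
have e2 : 0 < e / (2 * q) by rewrite divr_gt0 ?mulr_gt0.
have [d d0 dP] := He _ e2.
pose M := `|c| + 1.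
have M0 : 0 < M by rewrite ltr_wpDl.
have e3 : 0 < e / (2 * M) by rewrite divr_gt0 ?mulr_gt0.
near=> N.
have xd : `|x_ N - m| < d by rewrite distrC; near: N; move/cvgrPdist_lt: xm; exact.
have yq : rescale m N (x_ N) ^+ 4 <= q.
  have : `|y ^+ 4 - rescale m N (x_ N) ^+ 4| < 1 by near: N; move/cvgrPdist_lt: y4; exact.
  by rewrite ltr_norml /q; lra.
have ye : `|y ^+ 4 - rescale m N (x_ N) ^+ 4| <= e / (2 * M).
  by near: N; move/cvgrPdist_le: y4; exact.
rewrite rescale4 in yq ye.
set D := Hfun beta h p (x_ N) - Hfun beta h p m.
have -> : c * y ^+ 4 - N%:R * D = c * (y ^+ 4 - N%:R * (x_ N - m) ^+ 4) -
    N%:R * (D - c * (x_ N - m) ^+ 4) by ring.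
apply: le_trans (ler_normB _ _) _; rewrite !normrM.
have h1 : `|c| * `|y ^+ 4 - N%:R * (x_ N - m) ^+ 4| <= e / 2.
  apply: (@le_trans _ _ (M * (e / (2 * M)))).
    by apply: ler_pM => //; rewrite lerDl.
  by rewrite le_eqVlt; apply/orP; left; apply/eqP; field; rewrite gt_eqF.
have h2 : `|N%:R| * `|D - c * (x_ N - m) ^+ 4| <= e / 2.
  rewrite ger0_norm//; apply: le_trans (ler_wpM2l _ (dP _ xd)) _ => //.
  rewrite mulrCA; apply: le_trans (ler_wpM2l (ltW e2) yq) _.
  by rewrite le_eqVlt; apply/orP; left; apply/eqP; field; rewrite gt_eqF.
lra.
Unshelve. all: by end_near. Qed.

(** The product rule as an induction: [x^(p+1) - m^(p+1) = x (x^p - m^p) + (x - m) m^p]. *)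
Lemma scaled_power_cvg p m (x_ : nat -> R) y : rescale m N (x_ N) @[N --> \oo] --> y ->
  (N%:R : R) `^ (1 / 4) * (x_ N ^+ p - m ^+ p) @[N --> \oo] --> p%:R * m ^+ p.-1 * y.
Proof.
move=> xy; have xm := rescale_cvg_base xy.
elim: p => [|p IH].
  by rewrite !mul0r; under eq_fun do rewrite subrr mulr0; exact: cvg_cst.
have -> : p.+1%:R * m ^+ p.+1.-1 * y = m * (p%:R * m ^+ p.-1 * y) + y * m ^+ p.
  case: p {IH} => [|p]; rewrite -!pred_Sn; first by rewrite !expr0; ring.
  by rewrite -(natr1 p.+1) (exprS m p); ring.
have -> : (fun N => (N%:R : R) `^ (1 / 4) * (x_ N ^+ p.+1 - m ^+ p.+1)) =
    (fun N => x_ N * (N%:R `^ (1 / 4) * (x_ N ^+ p - m ^+ p)) + rescale m N (x_ N) * m ^+ p).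
  by apply/funext => N; rewrite /rescale !exprS; ring.
by apply: cvgD; apply: cvgM => //; exact: cvg_cst.
Qed.

Lemma scaled_weight_cvg p beta h m c t l (k_ : nat -> nat) y : -1 < m -> m < 1 ->
  (forall e, 0 < e -> exists2 d : R, 0 < d & forall x, `|x - m| < d ->
    `|Hfun beta h p x - Hfun beta h p m - c * (x - m) ^+ 4| <= e * (x - m) ^+ 4) ->
  @log_stirling R n @[n --> \oo] --> l ->
  (forall N, (k_ N <= N)%N) -> rescale m N (level N (k_ N)) @[N --> \oo] --> y ->
  scaled_weight p beta h m t N (k_ N) @[N --> \oo] -->
    expR (- l - (ln ((1 - m) / 2) + ln ((1 + m) / 2)) / 2) *
    quartic_exp c (p%:R * m ^+ p.-1 * t) y.
Proof.
move=> m_gt m_lt He ls kN ky.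
have h1 := log_binomial_prefactor_cvg m_gt m_lt ls kN ky.
have h2 := scaled_Hfun_cvg He ky.
have h3 := @scaled_power_cvg p _ _ _ ky.
rewrite /quartic_exp -expRD addrA.
have -> : p%:R * m ^+ p.-1 * t * y = t * (p%:R * m ^+ p.-1 * y) by ring.
rewrite /scaled_weight.
apply: (@cvg_comp _ _ _ _ (@expR R)); last exact: continuous_expR.
apply: cvgD; first exact: (cvgD h1 h2).
under eq_fun do rewrite -mulrA.
by apply: cvgM => //; exact: cvg_cst.
Qed.

End Scaled_weight_limit.

(** * Sums over levels as integrals *)

Section Scaled_sum.
Context {R : realType}.
Local Notation mu := (@lebesgue_measure R).
Implicit Types (N k : nat) (t x y : R).

(** The spacing [2 / N] of the levels, rescaled by [N^(1/4)]. The power is written as a cube so that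
    everything is rational in [N^(1/4)]. *)
Definition mesh N : R := 2 / (N%:R `^ (1 / 4)) ^+ 3.

Lemma powR14_ge1 N : (0 < N)%N -> 1 <= (N%:R : R) `^ (1 / 4).
Proof.
move=> N0; rewrite leNgt; apply/negP => r1.
have : ((N%:R : R) `^ (1 / 4)) ^+ 4 < 1 by rewrite exprn_ilt1 ?powR_ge0.
by rewrite powR14_4 ltrn1; case: N N0 {r1}.
Qed.

Lemma mesh_gt0 N : (0 < N)%N -> 0 < mesh N.
Proof. by move=> N0; rewrite divr_gt0// exprn_gt0// powR_gt0// ltr0n. Qed.

Lemma mesh_le2 N : (0 < N)%N -> mesh N <= 2.
Proof.
move=> N0; have r1 := powR14_ge1 N0.
rewrite ler_pdivrMr; last by rewrite exprn_gt0//; lra.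
by rewrite ler_peMr// exprn_ege1.
Qed.

Lemma mesh_cvg0 : mesh N @[N --> \oo] --> (0 : R).
Proof.
have rV : ((N%:R : R) `^ (1 / 4))^-1 @[N --> \oo] --> (0 : R).
  apply/gtr0_cvgV0; last exact: powR14_cvgy.
  by near=> N; rewrite powR_gt0// ltr0n; near: N; exact: nbhs_infty_gt.
have : 2 * (((N%:R : R) `^ (1 / 4))^-1) ^+ 3 @[N --> \oo] --> 2 * (0 : R) ^+ 3.
  apply: cvgM; first exact: cvg_cst.
  apply: (@cvg_comp _ _ _ _ (fun z : R => z ^+ 3)) rV _; exact: exprn_continuous.
rewrite expr0n mulr0; apply: cvg_trans; apply: near_eq_cvg; near=> N.
by rewrite /mesh exprVn.
Unshelve. all: by end_near. Qed.

Lemma rescale_level m N k : (0 < N)%N ->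
  rescale m N (level N k) = rescale m N 1 - k%:R * mesh N :> R.
Proof.
move=> N0; have r1 := powR14_ge1 N0; rewrite /rescale /level /mesh.
rewrite -[in X in _ * (X - _)](powR14_4 N); move: r1; set r := _ `^ _ => r1.
by field; lra.
Qed.

Context (p : nat) (beta h m c k0 : R).
Hypotheses (m_gt : -1 < m) (m_lt : m < 1) (k00 : 0 < k0).
Hypothesis Hk : forall x, x \in `[-1, 1] ->
  Hfun beta h p x - Hfun beta h p m <= - k0 * (x - m) ^+ 4.
Hypothesis He : forall e : R, 0 < e -> exists2 d : R, 0 < d & forall x, `|x - m| < d ->
  `|Hfun beta h p x - Hfun beta h p m - c * (x - m) ^+ 4| <= e * (x - m) ^+ 4.

(** The index of the cell containing [y]; the minimum with [N] makes it a valid index also when the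
    cells do not reach [y]. *)
Definition nearest_level N y : nat :=
  minn (Num.truncn ((rescale m N 1 - y) / mesh N)) N.

(** The rescaled levels fill [[- r (1 + m), r (1 - m)]] with [r = N^(1/4)], which eventually
    contains [y] because [-1 < m < 1]. *)
Lemma nearest_level_cell y : \forall N \near \oo,
  y \in cell (rescale m N 1) (mesh N) (nearest_level N y).
Proof.
have [ml mu'] : -1 < m /\ m < 1 by split.
near=> N.
have N0 : (0 < N)%N by near: N; exact: nbhs_infty_gt.
have d0 := mesh_gt0 N0.
have r1 := powR14_ge1 N0.
have rA : (y / (1 - m)) <= (N%:R : R) `^ (1 / 4).
  by near: N; move: (@powR14_cvgy R) => /cvgryPge; exact.
have rB : (- y / (1 + m)) <= (N%:R : R) `^ (1 / 4).
  by near: N; move: (@powR14_cvgy R) => /cvgryPge; exact.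
have z0 : 0 <= (rescale m N 1 - y) / mesh N.
  rewrite divr_ge0 ?(ltW d0)// subr_ge0 /rescale mulrC -ler_pdivrMl//; last lra.
  by rewrite mulrC.
have zN : (rescale m N 1 - y) / mesh N < N.+1%:R.
  rewrite ltr_pdivrMr// -natr1 mulrDl mul1r.
  have -> : N%:R * mesh N = 2 * N%:R `^ (1 / 4).
    rewrite /mesh -[X in X * _](powR14_4 N); move: r1; set r := _ `^ _ => r1.
    by field; lra.
  have : - y <= N%:R `^ (1 / 4) * (1 + m) by rewrite -ler_pdivrMr//; lra.
  by rewrite /rescale; lra.
have /andP[t1 t2] := truncn_itv z0.
have kN : (Num.truncn ((rescale m N 1 - y) / mesh N) <= N)%N.
  by rewrite -ltnS -(ltr_nat R); exact: le_lt_trans t1 zN.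
by rewrite /nearest_level (minn_idPl kN) mem_cell// t1.
Unshelve. all: by end_near. Qed.

Lemma rescale_nearest_level y :
  rescale m N (level N (nearest_level N y)) @[N --> \oo] --> y.
Proof.
apply/cvgrPdist_le => e e0; near=> N.
have N0 : (0 < N)%N by near: N; exact: nbhs_infty_gt.
have d0 := mesh_gt0 N0.
have : y \in cell (rescale m N 1) (mesh N) (nearest_level N y).
  by near: N; exact: nearest_level_cell.
have : `|0 - mesh N| <= e by near: N; move: mesh_cvg0 => /cvgrPdist_le; exact.
rewrite sub0r normrN gtr0_norm// => de.
rewrite inE /cell /= in_itv/= rescale_level// -natr1 mulrDl mul1r ler_norml.
by set q := _ * mesh N => /andP[? ?]; apply/andP; split; lra.
Unshelve. all: by end_near. Qed.

Lemma scaled_weight_dominated t : exists2 C : R, 0 <= C & forall N k y, (0 < N)%N -> (k <= N)%N ->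
  y \in cell (rescale m N 1) (mesh N) k ->
  (1 + `|rescale m N (level N k)|) * scaled_weight p beta h m t N k <= C * gauss_fun y.
Proof.
have [B BP] := scaled_weight_bound t m_gt m_lt k00 Hk.
have k02 : 0 < k0 / 2 by rewrite divr_gt0.
have [C C0 CP] := @quartic_domination R (k0 / 2) (`|t| * p%:R) k02.
(* The weight decays in the rescaled level [u], at distance at most 2 from [y]:
   [y^2 <= 2 u^2 + 2 (u - y)^2 <= 2 u^2 + 8]. *)
exists (expR B * C * expR 8); first by rewrite !mulr_ge0 ?expR_ge0// ltW.
move=> N k y N0 kN yk.
set u := rescale m N (level N k).
have d0 := mesh_gt0 N0; have d2 := mesh_le2 N0.
have uy : `|u - y| <= 2.
  move: yk; rewrite inE /cell/= in_itv/= /u rescale_level// -natr1 mulrDl mul1r ler_norml.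
  by set q := _ * mesh N => /andP[? ?]; apply/andP; split; lra.
have h1 := BP _ _ N0 kN; rewrite -/u in h1.
(* The sign turns the term in [|u|] into a genuine tilt [b u], as [quartic_domination] expects. *)
pose b := `|t| * p%:R * Num.sg u.
have bB : `|b| <= `|t| * p%:R.
  rewrite /b normrM ger0_norm ?mulr_ge0// normr_sg.
  by rewrite ler_piMr ?mulr_ge0//; case: (u != 0).
have bu : b * u = `|t| * p%:R * `|u| by rewrite /b -mulrA -normrEsg.
apply: (@le_trans _ _ (expR B * ((1 + `|u|) * expR (- (k0 / 2) * u ^+ 4 + b * u)))).
  rewrite mulrCA ler_wpM2l ?addr_ge0//; apply: le_trans h1 _.
  by rewrite -expRD ler_expR bu; lra.
rewrite -2!(mulrA (expR B)) ler_pM2l ?expR_gt0//; apply: le_trans (CP _ _ bB) _.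
rewrite -(mulrA C) ler_pM2l// /gauss_fun -expRD ler_expR.
have : `|u - y| ^+ 2 <= 2 ^+ 2 by rewrite lerXn2r ?nnegrE.
rewrite real_normK ?num_real// => h2.
have := sqr_ge0 (u - (y - u)); rewrite !sqrrB in h2 *.
by have := sqr_ge0 u; lra.
Qed.

Definition weight_limit (l : R) : R := expR (- l - (ln ((1 - m) / 2) + ln ((1 + m) / 2)) / 2).

(** For [N > 0] the left side is the integral of the step function with value the [k]-th summand on
    cell [k], and dominated convergence applies. Convergence of [F_] is required along all sequences
    of levels because the level in the cell of [y] moves with [N]. *)
Lemma scaled_sum_cvg t (l : R) (F_ : nat -> R -> R) (f : R -> R) (A y0 : R) : c < 0 ->
  @log_stirling R n @[n --> \oo] --> l ->
  (forall N x, (0 < N)%N -> -1 <= x <= 1 -> `|F_ N x| <= A * (1 + `|rescale m N x|)) ->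
  measurable_fun setT f -> (forall y, `|f y| <= A * (1 + `|y|)) ->
  (forall y (x_ : nat -> R), y <> y0 -> (forall N, -1 <= x_ N <= 1) ->
    rescale m N (x_ N) @[N --> \oo] --> y -> F_ N (x_ N) @[N --> \oo] --> f y) ->
  mesh N * \sum_(k < N.+1) scaled_weight p beta h m t N k * F_ N (level N k) @[N --> \oo] -->
  weight_limit l * quartic_int c (p%:R * m ^+ p.-1 * t) f.
Proof.
move=> c0 ls FA mf fA Ff.
have A0 : 0 <= A by have := le_trans (normr_ge0 _) (fA 0); rewrite normr0 addr0 mulr1.
have [C C0 CP] := scaled_weight_dominated t.
pose a N k := scaled_weight p beta h m t N k * F_ N (level N k).
pose g N := step_fun (rescale m N 1) (mesh N) N.+1 (a N).
have ga N y k : (0 < N)%N -> (k < N.+1)%N -> y \in cell (rescale m N 1) (mesh N) k ->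
    `|a N k| <= A * C * gauss_fun y.
  move=> N0 kN yk; rewrite /a normrM (ger0_norm (expR_ge0 _)).
  have Fk := FA _ _ N0 (@level_itv R N k N0 kN).
  have W0 : 0 <= scaled_weight p beta h m t N k by exact: expR_ge0.
  apply: le_trans (ler_wpM2l W0 Fk) _.
  by rewrite mulrCA -(mulrA A); apply: ler_wpM2l => //; rewrite mulrC; exact: CP.
have mg N : measurable_fun setT (g N) by exact: measurable_step_fun.
have gE N : (0 < N)%N -> (\int[mu]_y g N y)%R = mesh N * \sum_(k < N.+1) a N k.
  by move=> N0; rewrite Rintegral_step_fun//; exact: mesh_gt0.
have intE : weight_limit l * quartic_int c (p%:R * m ^+ p.-1 * t) f =
    (\int[mu]_y (weight_limit l * (f y * quartic_exp c (p%:R * m ^+ p.-1 * t) y)))%R.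
  by rewrite RintegralZl//; exact: quartic_integrable fA.
rewrite intE.
have : (\int[mu]_y g N y)%R @[N --> \oo] -->
    (\int[mu]_y (weight_limit l * (f y * quartic_exp c (p%:R * m ^+ p.-1 * t) y)))%R.
  apply: (@dominated_cvg_Rintegral _ _ _ (A * C) y0) => //.
  - apply: measurable_funM => //; apply: measurable_funM => //; exact: measurable_quartic_exp.
  - move=> y yy0.
    have kN N : (nearest_level N y <= N)%N by exact: geq_minr.
    have ry := @rescale_nearest_level y.
    have h1 := @scaled_weight_cvg _ p beta h m c t l _ y m_gt m_lt He ls kN ry.
    (* [level_itv] asks for [0 < N], so index 0 gets the value 0. *)
    pose x_ N : R := if N is 0 then 0 else level N (nearest_level N y).
    have x_E : \forall N \near \oo, level N (nearest_level N y) = x_ N.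
      by exists 1%N => // -[|N].
    have rx : rescale m N (x_ N) @[N --> \oo] --> y.
      apply: cvg_trans ry; apply: near_eq_cvg; move: x_E; apply: filterS => N -> //.
    have x1 N : -1 <= x_ N <= 1.
      case: N => [|N]; rewrite /x_; first by rewrite lerN10 ler01.
      exact: level_itv.
    have h2 := Ff y x_ yy0 x1 rx.
    have h3 : scaled_weight p beta h m t N (nearest_level N y) * F_ N (x_ N) @[N --> \oo] -->
        weight_limit l * (f y * quartic_exp c (p%:R * m ^+ p.-1 * t) y).
      by rewrite [f y * _]mulrC mulrA; exact: cvgM.
    apply: cvg_trans h3; apply: near_eq_cvg; near=> N.
    have yk : y \in cell (rescale m N 1) (mesh N) (nearest_level N y).
      by near: N; exact: nearest_level_cell.
    have N0 : (0 < N)%N by near: N; exact: nbhs_infty_gt.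
    have -> : x_ N = level N (nearest_level N y) by case: (N) N0.
    by rewrite /g (step_fun_cell (mesh_gt0 N0) _ _ yk)// ltnS; exact: kN.
  - move=> N y N0; rewrite /g; have [->|[k [kN yk ->]]] := step_fun_cases (rescale m N 1) (mesh_gt0 N0) N.+1 (a N) y.
      by rewrite normr0; apply: mulr_ge0 (mulr_ge0 A0 C0) (expR_ge0 _).
    exact: ga.
apply: cvg_trans; apply: near_eq_cvg; near=> N; rewrite gE//.
by near: N; exact: nbhs_infty_gt.
Unshelve. all: by end_near. Qed.

End Scaled_sum.

(** * The maximum likelihood estimate *)

Section Maximum_likelihood.
Context {R : realType}.
Context (p : nat) (h : R).
Implicit Types (N : nat) (b : R).

Definition moment N b : R :=
  gibbs_expectation b h p (fun s : config N => magnetization s ^+ p).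

Lemma continuous_sum (I : Type) (r : seq I) (F : I -> R -> R) :
  (forall i, continuous (F i)) -> continuous (fun x => \sum_(i <- r) F i x).
Proof.
move=> cF x; rewrite /continuous_at; elim: r => [|i r IH].
  by rewrite big_nil; under eq_fun do rewrite big_nil; exact: cvg_cst.
rewrite big_cons; under eq_fun do rewrite big_cons.
by apply: cvgD => //; exact: cF.
Qed.

Lemma continuous_gibbs_weight N (s : config N) :
  continuous (fun b => gibbs_weight b h p s).
Proof.
move=> b; rewrite /continuous_at /gibbs_weight.
apply: (@cvg_comp _ _ _ _ (@expR R)); last exact: continuous_expR.
apply: cvgM; first exact: cvg_cst.
apply: cvgD; last exact: cvg_cst.
by apply: cvgM; [exact: cvg_id|exact: cvg_cst].
Qed.

Lemma momentE N b : moment N b =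
  (\sum_(s : config N) gibbs_weight b h p s * magnetization s ^+ p) /
  \sum_(s : config N) gibbs_weight b h p s.
Proof.
rewrite mulr_suml; apply: eq_bigr => s _.
by rewrite gibbsE mulrAC.
Qed.

Lemma continuous_moment N : continuous (moment N).
Proof.
rewrite (funext (momentE N)) => b; apply: cvgM.
  apply: (@continuous_sum _ _ (fun s b => gibbs_weight b h p s * magnetization s ^+ p)) => s x.
  by apply: cvgM; [exact: continuous_gibbs_weight|exact: cvg_cst].
apply: cvgV; first by rewrite gt_eqF// sum_gibbs_weight_gt0.
by apply: (@continuous_sum _ _ (fun s b => gibbs_weight b h p s)) => s; exact: continuous_gibbs_weight.
Qed.

Lemma moment_sub N b M : moment N b - M =
  (\sum_(s : config N) gibbs_weight b h p s * (magnetization s ^+ p - M)) /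
  \sum_(s : config N) gibbs_weight b h p s.
Proof.
rewrite momentE; under [in RHS]eq_bigr do rewrite mulrBr.
rewrite sumrB -mulr_suml mulrBl; congr (_ - _).
by rewrite mulrAC divff ?mul1r// gt_eqF// sum_gibbs_weight_gt0.
Qed.

(** With [M] the moment at [b] and [a = N (b' - b) >= 0], [(z - M) (expR (a z) - expR (a M)) >= 0]
    for every value [z] of mean^p. *)
Lemma moment_nondecreasing N : {homo moment N : b b' / b <= b'}.
Proof.
move=> b b' bb'; rewrite -subr_ge0 moment_sub divr_ge0//; last exact/ltW/sum_gibbs_weight_gt0.
set M := moment N b; pose a := N%:R * (b' - b).
have a0 : 0 <= a by rewrite mulr_ge0// subr_ge0.
have S0 : \sum_(s : config N) gibbs_weight b h p s * (magnetization s ^+ p - M) = 0.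
  have /eqP := subrr M; rewrite {1}/M moment_sub mulf_eq0 invr_eq0.
  by rewrite [X in _ || X]gt_eqF ?orbF ?sum_gibbs_weight_gt0// => /eqP.
suff : expR (a * M) * \sum_(s : config N) gibbs_weight b h p s * (magnetization s ^+ p - M) <=
    \sum_(s : config N) gibbs_weight b' h p s * (magnetization s ^+ p - M).
  by rewrite S0 mulr0.
rewrite mulr_sumr; apply: ler_sum => s _.
rewrite (gibbs_weight_shift h p b b') -/a mulrCA -mulrA ler_pM2l ?expR_gt0//.
rewrite -subr_ge0 -mulrBl.
have [dM|dM] := leP M (magnetization s ^+ p).
  by rewrite mulr_ge0 ?subr_ge0// ler_expR ler_wpM2l.
by rewrite mulr_le0// subr_le0 ?(ltW dM)// ler_expR ler_wpM2l// ltW.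
Qed.

(** The tangent-line inequality of the concave log-likelihood, obtained from [1 + x <= expR x]. *)
Lemma likelihood_le_of_moment N (s : config N) b b' :
  0 <= (b' - b) * (moment N b - magnetization s ^+ p) ->
  likelihood h p s b' <= likelihood h p s b.
Proof.
move=> b0; rewrite likelihood_le; set W := \sum_t _.
have W0 : 0 < W by exact: sum_gibbs_weight_gt0.
apply: (@le_trans _ _ (\sum_(t : config N) gibbs_weight b h p t *
    (1 + N%:R * (b' - b) * (magnetization t ^+ p - magnetization s ^+ p)))).
  have -> : \sum_(t : config N) gibbs_weight b h p t *
      (1 + N%:R * (b' - b) * (magnetization t ^+ p - magnetization s ^+ p)) =
      W + N%:R * ((b' - b) * (moment N b - magnetization s ^+ p)) * W.
    rewrite moment_sub -/W -!mulrA mulVf ?mulr1 ?gt_eqF//.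
    rewrite /W mulrA mulr_sumr -big_split/=; apply: eq_bigr => t _; ring.
  by rewrite lerDl mulr_ge0 ?(ltW W0)// mulr_ge0.
by apply: ler_sum => t _; rewrite ler_pM2l ?expR_gt0// expR_ge1Dx.
Qed.

(** With [mle_gt_of_gt_moment] it encloses the event [mle <= b] between a strict and a weak
    comparison of the observed power with the moment. *)
Lemma mle_le_of_lt_moment N (s : config N) b :
  magnetization s ^+ p < moment N b -> (mle h p s <= b%:E)%E.
Proof.
move=> Mb; rewrite /mle; case: asboolP => [ne|ne].
  have /likelihood_argmaxE Eb := xgetPex (0 : R) ne.
  rewrite lee_fin leNgt; apply/negP => /ltW /moment_nondecreasing.
  by move=> /(_ N); rewrite {2}/moment Eb leNgt Mb.
case: asboolP => [hom|_]; last exact: leNye.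
(* A nondecreasing likelihood would make [b] a maximizer, since to the right of [b] it does not
   exceed its value at [b]. *)
exfalso; apply: ne; exists b => b'.
have [b'b|bb'] := leP b' b; first exact: hom.
by apply: likelihood_le_of_moment; rewrite mulr_ge0// subr_ge0 ltW.
Qed.

Lemma mle_gt_of_gt_moment N (s : config N) b :
  moment N b < magnetization s ^+ p -> (b%:E < mle h p s)%E.
Proof.
move=> Mb; rewrite /mle; case: asboolP => [ne|ne].
  have /likelihood_argmaxE Eb := xgetPex (0 : R) ne.
  rewrite lte_fin ltNge; apply/negP => /moment_nondecreasing.
  by move=> /(_ N); rewrite {1}/moment Eb leNgt Mb.
case: asboolP => [_|hom]; first exact: ltry.
exfalso; apply: hom => b1 b2 b12.
have [Mb2|Mb2] := leP (moment N b2) (magnetization s ^+ p).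
  by apply: likelihood_le_of_moment; rewrite mulr_le0// subr_le0.
(* Otherwise the continuous moment takes the observed value between [b] and [b2], and a maximizer
   exists. *)
exfalso; apply: ne.
have bb2 : b <= b2.
  rewrite leNgt; apply/negP => /ltW /moment_nondecreasing => /(_ N).
  by rewrite leNgt (lt_trans Mb Mb2).
have cm : {within `[b, b2], continuous (moment N)}.
  by apply: continuous_subspaceT; exact: continuous_moment.
have [|z _ Ez] := IVT bb2 cm (v := magnetization s ^+ p).
  by rewrite ge_min le_max (ltW Mb) (ltW Mb2) orbT.
by exists z; apply/likelihood_argmaxE.
Qed.

Lemma scaled_mle_le N (s : config N) (beta t : R) : (0 < N)%N ->
  (((N%:R `^ (3 / 4))%:E * (mle h p s - beta%:E))%E <= t%:E)%E =
  (mle h p s <= (beta + t / N%:R `^ (3 / 4))%:E)%E.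
Proof.
move=> N0; have r0 : 0 < (N%:R : R) `^ (3 / 4) by rewrite powR_gt0// ltr0n.
case: (mle h p s) => [b| |].
- rewrite -EFinB -EFinM !lee_fin -ler_pdivlMl// lerBlDl.
  by rewrite mulrC.
- by rewrite /= gt0_muley.
- by rewrite /= gt0_muleNy// !leNye.
Qed.

End Maximum_likelihood.

(** * The limit theorem *)

Section Limit_theorem.
Context {R : realType} (p : nat) (beta h m : R).
Hypotheses (p3 : (3 <= p)%N) (mmax : unique_global_maximizer (Hfun beta h p) m)
  (m_gt : -1 < m) (m_lt : m < 1) (H2m : ((Hfun beta h p)^`(2))%classic m = 0).
Implicit Types (N : nat) (t : R).

Local Notation c := (quartic_coef p beta h m).
Local Notation s := (p%:R * m ^+ p.-1).

Let c0 : c < 0. Proof. exact: quartic_coef_lt0. Qed.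

Let s0 : s != 0.
Proof.
rewrite mulf_neq0//; first by rewrite pnatr_eq0 -lt0n (leq_trans _ p3).
by rewrite expf_neq0// (special_point_neq0 p3 m_gt m_lt H2m).
Qed.

Let He := quartic_expansion mmax m_gt m_lt H2m.

Lemma special_Hfun_le_quartic : exists2 k0 : R, 0 < k0 & forall x, x \in `[-1, 1] ->
  Hfun beta h p x - Hfun beta h p m <= - k0 * (x - m) ^+ 4.
Proof.
(* A Taylor error of half the quartic coefficient leaves the other half as local decay. *)
have c2 : 0 < - c / 2 by rewrite divr_gt0// oppr_gt0.
have [d d0 dP] := He c2.
apply: (Hfun_le_quartic mmax m_gt m_lt c2 d0) => x /dP.
by rewrite ler_norml => /andP[_]; set q := _ ^+ 4; lra.
Qed.

Let perturbed N t : R := beta + t / N%:R `^ (3 / 4).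

(** Quotient of two instances of [scaled_sum_cvg], for [F_] and for the constant 1; the mesh and
    [weight_limit] cancel. *)
Lemma gibbs_expectation_cvg t (F_ : nat -> R -> R) (f : R -> R) (A y0 : R) :
  (forall N x, (0 < N)%N -> -1 <= x <= 1 -> `|F_ N x| <= A * (1 + `|rescale m N x|)) ->
  measurable_fun setT f -> (forall y, `|f y| <= A * (1 + `|y|)) ->
  (forall y (x_ : nat -> R), y <> y0 -> (forall N, -1 <= x_ N <= 1) ->
    rescale m N (x_ N) @[N --> \oo] --> y -> F_ N (x_ N) @[N --> \oo] --> f y) ->
  gibbs_expectation (perturbed N t) h p (fun s : config N => F_ N (magnetization s))
    @[N --> \oo] --> quartic_int c (s * t) f / quartic_int c (s * t) (cst 1).
Proof.
move=> FA mf fA Ff.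
have [k0 k00 Hk] := special_Hfun_le_quartic.
have [l ls] := @log_stirling_cvg R.
have h1 := scaled_sum_cvg m_gt m_lt k00 Hk He c0 ls FA mf fA Ff.
have h2 : mesh N * \sum_(k < N.+1) scaled_weight p beta h m t N k * (cst 1 : R -> R) (level N k)
   @[N --> \oo] --> weight_limit m l * quartic_int c (s * t) (cst 1).
  apply: (@scaled_sum_cvg _ _ _ _ _ _ _ m_gt m_lt k00 Hk He t l (fun=> cst 1) (cst 1) 1 0) => //.
  - by move=> N x _ _; rewrite mul1r normr1 lerDl.
  - by move=> y; rewrite mul1r normr1 lerDl.
  - by move=> y x_ _ _ _; exact: cvg_cst.
have K0 : weight_limit m l != 0 by rewrite gt_eqF// expR_gt0.
have Z0 : quartic_int c (s * t) (cst 1) != 0 by rewrite gt_eqF// quartic_int_cst1_gt0.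
have KZ : weight_limit m l * quartic_int c (s * t) (cst 1) != 0 by rewrite mulf_neq0.
have -> : quartic_int c (s * t) f / quartic_int c (s * t) (cst 1) =
    (weight_limit m l * quartic_int c (s * t) f) /
    (weight_limit m l * quartic_int c (s * t) (cst 1)).
  by rewrite -mulf_div divff ?mul1r.
have h3 : (mesh N * \sum_(k < N.+1) scaled_weight p beta h m t N k * F_ N (level N k)) /
    (mesh N * \sum_(k < N.+1) scaled_weight p beta h m t N k * (cst 1 : R -> R) (level N k))
    @[N --> \oo] --> (weight_limit m l * quartic_int c (s * t) f) /
    (weight_limit m l * quartic_int c (s * t) (cst 1)).
  by apply: cvgM; [exact: h1|exact: cvgV].
apply: cvg_trans h3; apply: near_eq_cvg; near=> N.
have N0 : (0 < N)%N by near: N; exact: nbhs_infty_gt.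
rewrite (gibbs_expectation_scaled p beta h m t (F_ N) N0) /=.
rewrite -mulf_div divff ?mul1r ?gt_eqF ?mesh_gt0//; congr (_ / _).
by apply: eq_bigr => k _; rewrite mulr1.
Unshelve. all: by end_near. Qed.

Lemma moment_cvg t :
  N%:R `^ (1 / 4) * (moment p h N (perturbed N t) - m ^+ p) @[N --> \oo] --> limit_mean c s t.
Proof.
have m1 : `|m| <= 1 by rewrite ler_norml !ltW.
(* In the growth constant, [p] serves the rescaled power through its Lipschitz bound, and [|s|]
   serves its limit. *)
have := @gibbs_expectation_cvg t (fun N x => N%:R `^ (1 / 4) * (x ^+ p - m ^+ p))
  (fun y => s * y + 0) (p%:R + `|s|) 0.
rewrite quartic_int_affine// mul0r addr0 -mulrA -/(quartic_mean c (s * t)).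
have -> : (fun N => gibbs_expectation (perturbed N t) h p
    (fun s : config N => N%:R `^ (1 / 4) * (magnetization s ^+ p - m ^+ p))) =
    (fun N => N%:R `^ (1 / 4) * (moment p h N (perturbed N t) - m ^+ p)).
  apply/funext => N; rewrite moment_sub mulr_suml mulr_sumr; apply: eq_bigr => x _.
  by rewrite gibbsE mulrCA mulrAC.
apply.
- move=> N x N0 x1; rewrite normrM (ger0_norm (powR_ge0 _ _)).
  have x1' : `|x| <= 1 by rewrite ler_norml.
  apply: le_trans (ler_wpM2l (powR_ge0 _ _) (norm_subrXX_le p x1' m1)) _.
  have rE : `|rescale m N x| = N%:R `^ (1 / 4) * `|x - m|.
    by rewrite /rescale normrM ger0_norm// powR_ge0.
  by rewrite mulrCA -rE; apply: ler_pM => //; rewrite ?lerDl ?lerDr.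
- by apply: measurable_funD => //; exact: measurable_funM.
- move=> y; rewrite addr0 (normrM s).
  by apply: ler_pM => //; rewrite ?lerDl ?lerDr.
- move=> y x_ _ _ xy; rewrite addr0; exact: scaled_power_cvg.
Qed.

(* [test] stands for [<] or [<=]: ties do not contribute to the limit. *)
Lemma gibbs_probability_cvg t (test : R -> R -> bool) :
  (forall u v w : R, 0 < w -> test (w * (u - m ^+ p)) (w * (v - m ^+ p)) = test u v) ->
  (forall (u_ v_ : nat -> R) u v, u != v -> u_ n @[n --> \oo] --> u -> v_ n @[n --> \oo] --> v ->
    \forall n \near \oo, test (u_ n) (v_ n) = (u <= v)) ->
  \sum_(x : config N) gibbs beta h p x *
    (test (magnetization x ^+ p) (moment p h N (perturbed N t)))%:R
    @[N --> \oo] --> limit_cdf c s t.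
Proof.
move=> test_affine test_near.
pose F_ N x : R := (test (x ^+ p) (moment p h N (perturbed N t)))%:R.
(* The expectation is under the true parameter, while [t] appears only in the threshold; the
   excluded point is the tie [s y = limit_mean c s t]. *)
have := @gibbs_expectation_cvg 0 F_ (\1_[set y : R | s * y <= limit_mean c s t]) 1
  (limit_mean c s t / s).
rewrite mulr0 -/(limit_cdf c s t).
have -> : (fun N => gibbs_expectation (perturbed N 0) h p
    (fun x : config N => F_ N (magnetization x))) =
    (fun N => \sum_(x : config N) gibbs beta h p x *
    (test (magnetization x ^+ p) (moment p h N (perturbed N t)))%:R).
  by apply/funext => N; rewrite {1}/perturbed mul0r addr0.
apply.
- move=> N x _ _; rewrite mul1r /F_; case: (test _ _); rewrite ?normr1 ?normr0 ?lerDl//.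
- exact: measurable_le_indic.
- move=> y; rewrite mul1r indicE; case: (_ \in _); rewrite ?normr1 ?normr0 ?lerDl//.
move=> y x_ yy0 _ xy.
have sy : s * y != limit_mean c s t.
  by apply/eqP => E; apply: yy0; rewrite -E mulrC mulKf.
have h1 := @scaled_power_cvg _ p _ _ _ xy.
have := test_near _ _ _ _ sy h1 (@moment_cvg t).
move=> near_test; apply: cvg_near_cst; near=> N.
rewrite indic_leE /F_; congr (nat_of_bool _)%:R.
have N0 : 0 < (N%:R : R) `^ (1 / 4).
  by rewrite powR_gt0// ltr0n; near: N; exact: nbhs_infty_gt.
by rewrite -(test_affine _ _ _ N0); near: N.
Unshelve. all: by end_near. Qed.

Lemma scaled_mle_cvg t :
  \sum_(x : config N | (((N%:R `^ (3 / 4))%:E * (mle h p x - beta%:E))%E <= t%:E)%E) gibbs beta h p x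
    @[N --> \oo] --> limit_cdf c s t.
Proof.
have affine_le (u v w : R) : 0 < w -> (w * (u - m ^+ p) <= w * (v - m ^+ p)) = (u <= v).
  by move=> w0; rewrite ler_pM2l// lerD2r.
have affine_lt (u v w : R) : 0 < w -> (w * (u - m ^+ p) < w * (v - m ^+ p)) = (u < v).
  by move=> w0; rewrite ltr_pM2l// ltrD2r.
have near_le (u_ v_ : nat -> R) u v : u != v -> u_ n @[n --> \oo] --> u -> v_ n @[n --> \oo] --> v ->
    \forall n \near \oo, (u_ n <= v_ n) = (u <= v).
  by move=> uv uu vv; apply: filterS (near_eq_le uv uu vv) => n [].
have near_lt (u_ v_ : nat -> R) u v : u != v -> u_ n @[n --> \oo] --> u -> v_ n @[n --> \oo] --> v ->
    \forall n \near \oo, (u_ n < v_ n) = (u <= v).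
  by move=> uv uu vv; apply: filterS (near_eq_le uv uu vv) => n [].
have h1 := @gibbs_probability_cvg t (fun u v => u < v) affine_lt near_lt.
have h2 := @gibbs_probability_cvg t (fun u v => u <= v) affine_le near_le.
apply: squeeze_cvgr h1 h2; near=> N.
have N0 : (0 < N)%N by near: N; exact: nbhs_infty_gt.
have g0 (x : config N) : 0 <= gibbs beta h p x.
  by rewrite gibbsE divr_ge0 ?expR_ge0// ltW// sum_gibbs_weight_gt0.
rewrite [X in _ <= X <= _]big_mkcond/=; apply/andP; split; apply: ler_sum => x _.
  rewrite scaled_mle_le// -/(perturbed N t).
  have [/mle_le_of_lt_moment ->|_] := boolP (magnetization x ^+ p < _); first by rewrite mulr1.
  by rewrite mulr0; case: ifP.
rewrite scaled_mle_le// -/(perturbed N t).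
have [_|] := boolP (magnetization x ^+ p <= _); first by rewrite mulr1; case: ifP.
by rewrite -ltNge => /mle_gt_of_gt_moment; rewrite ltNge => /negbTE ->; rewrite mulr0.
Unshelve. all: by end_near. Qed.

End Limit_theorem.

Theorem theorem2p5 (R : realType) (p : nat) (beta h m : R) :
  (3 <= p)%N -> 0 <= beta -> p_special p beta h ->
  unique_global_maximizer (Hfun beta h p) m ->
  exists G2 : probability (measurableTypeR R) R,
    [/\ converges_in_distribution
          (fun (N : nat) (s : config N) => gibbs beta h p s)
          (fun (N : nat) (s : config N) =>
             ((N%:R `^ (3 / 4))%:E * (mle h p s - beta%:E))%E) G2,
        0 < m ^+ p.-1 ->
          forall t, distribution_function G2 t = G2_formula beta h p m t
      & m ^+ p.-1 < 0 ->
          forall t, distribution_function G2 t = 1 - G2_formula beta h p m t].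
Proof.
move=> p3 _ [m' [m'max m'1 H2m']] mmax.
have mE : m' = m.
  apply/eqP/negPn/negP => /eqP mm'.
  have := lt_trans (mmax.2 _ m'max.1 mm') (m'max.2 _ mmax.1 (nesym mm')).
  by rewrite ltxx.
move: m'1 H2m'; rewrite mE => /andP[m_gt m_lt] H2m {m' m'max mE}.
pose c := quartic_coef p beta h m; pose s := p%:R * m ^+ p.-1.
have c0 : c < 0 by exact: quartic_coef_lt0.
have p0 : 0 < p%:R :> R by rewrite ltr0n (leq_trans _ p3).
have s0 : s != 0.
  by rewrite mulf_neq0 ?(gt_eqF p0)// expf_neq0// (special_point_neq0 p3 m_gt m_lt H2m).
(* [G2] is built from [limit_cdf] and matched with [G2_formula] once the sign of [m^(p-1)] is
   given. *)
have [G2 G2E] := exists_probability_cdf (@limit_cdf_nondecreasing R c s c0)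
  (fun u x => @limit_cdf_cvg R c s u x c0 s0) (fun u => @limit_cdf_cvgNy R c s u c0 s0)
  (fun u => @limit_cdf_cvgy R c s u c0 s0).
have F_lawE bbar : F_law beta h p m bbar 0 = quartic_law c (s * bbar).
  by rewrite /F_law /s addr0; congr quartic_law; ring.
have formulaE t : G2_formula beta h p m t =
    distribution_function (quartic_law c 0) (quartic_mean c (s * t)).
  by rewrite /G2_formula !F_lawE mulr0 Rintegral_quartic_law.
exists G2; split.
- by move=> t _; rewrite G2E; exact: scaled_mle_cvg.
- by move=> m0 t; rewrite G2E formulaE limit_cdf_pos// mulr_gt0.
- by move=> m0 t; rewrite G2E formulaE limit_cdf_neg// pmulr_rlt0.
Qed.
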